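(* Consider a dual reductive pair $(G(m),G'(n))$ in a symplectic group $Sp$ over a local field ($\mathbb R$ or $p$-adic). Let $n=n_1+n_2$, and let $(G(m),G'(n_i))$ be the corresponding dual reductive pair in $Sp^{(i)}$ ($i=1,2$). Let $\omega$ be the oscillator representation associated with $Sp$ and $\omega_i$ the oscillator representation associated with $Sp^{(i)}$. Let $\pi$ be an irreducible unitary representation of $\tilde G(m)$. Suppose that the matrix coefficients with respect to $\omega_1^\infty|_{\tilde G(m)}$ and with respect to $\omega_2^\infty|_{\tilde G(m)}\otimes\pi^\infty$ are square integrable on $\tilde G(m)$. Let $\xi\in\omega_1^\infty\otimes\omega_2^\infty$ and $u\in\pi^\infty$. Then $$\int_{\tilde G(m)}(\omega(g)\xi,\xi)\,(\pi(g)u,u)\,dg\ \ge\ 0 .$$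
   Context: A dual reductive pair in $Sp$ is a pair of reductive subgroups of $Sp$ that are mutual centralizers (Howe). Here $G'(n_1)$ and $G'(n_2)$ are groups of the same type as $G'(n)$, embedded (block) diagonally as $G'(n_1)\times G'(n_2)\subset G'(n)$ with $n_1+n_2=n$; correspondingly the symplectic space of $Sp$ is the orthogonal direct sum of the symplectic spaces of $Sp^{(1)}$ and $Sp^{(2)}$, $Sp^{(1)}\times Sp^{(2)}\subset Sp$ is diagonally embedded, $G(m)$ acts diagonally (so it maps into both $Sp^{(1)}$ and $Sp^{(2)}$), and $(G(m),G'(n_i))$ is a dual reductive pair in $Sp^{(i)}$. The oscillator (Weil) representations $\omega,\omega_1,\omega_2$ are unitary representations of the metaplectic covers $\widetilde{Sp},\widetilde{Sp^{(1)}},\widetilde{Sp^{(2)}}$ (formed with respect to compatible additive characters). $\tilde G(m)$ denotes the finite cover of $G(m)$ induced by the metaplectic covers, on which $\omega,\omega_1,\omega_2$ are all defined by restriction (pullback); $\omega$ is identified with $\omega_1\otimes\omega_2$ (Hilbert space tensor product) compatibly with the action of $\tilde G(m)$. $dg$ is Haar measure on the unimodular group $\tilde G(m)$. $\omega_i^\infty$ is the space of smooth vectors of $\omega_i$ as a representation of $\widetilde{Sp^{(i)}}$ (the Schwartz, resp. Schwartz–Bruhat, space in the Schrödinger model), and $\pi^\infty$ is the space of smooth vectors of $\pi$. $\omega_1^\infty\otimes\omega_2^\infty$ and $\omega_2^\infty\otimes\pi^\infty$ are algebraic tensor products (finite sums of pure tensors). Square integrability of the matrix coefficients means: $g\mapsto(\omega_1(g)a,b)$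 is in $L^2(\tilde G(m))$ for all $a,b\in\omega_1^\infty$, and $g\mapsto(\omega_2(g)c,d)(\pi(g)v,w)$ is in $L^2(\tilde G(m))$ for all $c,d\in\omega_2^\infty$, $v,w\in\pi^\infty$. *)

(* Defs.v *)
From HB Require Import structures.
From mathcomp Require Import all_boot all_order all_algebra.
From mathcomp Require Import complex.
From mathcomp Require Import all_classical all_reals all_analysis.
Import numFieldNormedType.Exports.

Set Implicit Arguments.
Unset Strict Implicit.
Unset Printing Implicit Defensive.

Import Order.TTheory GRing.Theory Num.Theory.
Local Open Scope classical_set_scope.
Local Open Scope ring_scope.
Local Open Scope complex_scope.

#[short(type="topFieldType")]
HB.structure Definition TopField := {F of Topological F & GRing.Field F}.

Variant local_kind := RealField | PadicField.

Record ultrametric_abs (R : realType) (F : fieldType) (a : F -> R) : Prop := {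
  uabs_ge0 : forall x, 0 <= a x ;
  uabs_eq0 : forall x, a x = 0 <-> x = 0 ;
  uabsM : {morph a : x y / x * y} ;
  uabsD : forall x y, a (x + y) <= Num.max (a x) (a y) }.

(* p-adic fields, i.e. finite extensions of the fields Q_p, are the locally
   compact nontrivially ultrametrically valued fields of characteristic 0. *)
Definition is_local_field (R : realType) (k : local_kind) (F : topFieldType) :
    Prop :=
  match k with
  | RealField => exists (f : {rmorphism R -> F}) (g : F -> R),
      [/\ cancel f g, cancel g f, continuous f & continuous g]
  | PadicField => [pchar F] =i pred0 /\ exists a : F -> R,
      [/\ ultrametric_abs a,
          exists2 x, x != 0 & a x != 1,
          forall x (A : set F), nbhs x A <->
            exists2 e, 0 < e & [set y | a (y - x) < e] `<=` A
        & exists2 K : set F, nbhs 0 K & compact K]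
  end.

Definition additive_character (R : realType) (F : topFieldType)
    (psi : F -> R[i]) : Prop :=
  [/\ {morph psi : x y / x + y >-> x * y},
      forall x, `|psi x| = 1,
      continuous (psi : F -> R[i]^o)
    & exists x, psi x != 1].

HB.mixin Record isTopGroup G of PointedTopological G & Group G := {
  mulg_continuous : continuous (fun z : G * G => (z.1 * z.2)%g) ;
  invg_continuous : continuous (fun x : G => (x^-1)%g) }.

(* The distinguished point of the library's pointed types is arbitrary; it is
   there only because measurable types are required to be inhabited. *)
#[short(type="topGroupType")]
HB.structure Definition TopGroup :=
  {G of PointedTopological G & Group G & isTopGroup G}.

Notation borel T := (g_sigma_algebraType (@open T)).

Definition continuous_hom (T T' : topGroupType) (f : T -> T') : Prop :=
  continuous f /\ {morph f : x y / (x * y)%g}.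

Section Haar.
Context (R : realType) (T : topGroupType)
        (mu : {measure set (borel T) -> \bar R}).

Record left_haar_measure : Prop := {
  haar_left : forall (g : T) (A : set (borel T)), measurable A ->
    mu [set (g * x)%g | x in A] = mu A ;
  haar_open_gt0 : forall U : set T, open U -> U !=set0 -> (0 < mu U)%E ;
  haar_compact_fin : forall K : set T, compact K -> (mu K < +oo)%E ;
  haar_outer : forall A : set (borel T), measurable A ->
    mu A = ereal_inf [set mu U | U in [set U : set T | open U /\ A `<=` U]] ;
  haar_inner : forall U : set T, open U ->
    mu U = ereal_sup [set mu K | K in [set K : set T | compact K /\ K `<=` U]]
  }.

(* Bi-invariance: the groups integrated over are unimodular. *)
Definition haar_measure : Prop :=
  left_haar_measure /\
  forall (g : T) (A : set (borel T)), measurable A ->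
    mu [set (x * g)%g | x in A] = mu A.

Definition square_integrable (f : T -> R[i]) : Prop :=
  [/\ measurable_fun [set: borel T] (fun x => complex.Re (f x)),
      measurable_fun [set: borel T] (fun x => complex.Im (f x))
    & (\int[mu]_x (complex.Re (`|f x| ^+ 2))%:E < +oo)%E].

Definition cintegrable (f : T -> R[i]) : Prop :=
  mu.-integrable [set: borel T] (fun x => (complex.Re (f x))%:E) /\
  mu.-integrable [set: borel T] (fun x => (complex.Im (f x))%:E).

Definition cintegral (f : T -> R[i]) : R[i] :=
  Complex (Rintegral mu setT (fun x => complex.Re (f x)))
          (Rintegral mu setT (fun x => complex.Im (f x))).

End Haar.

HB.mixin Record hasInnerProduct (R : realType) H
    of CompleteNormedModule R[i] H := {
  ip : H -> H -> R[i] ;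
  ip_linearl : forall v, linear (ip^~ v : H -> R[i]^o) ;
  ipC : forall u v, ip u v = (ip v u)^*%C ;
  ip_norm : forall v, ip v v = `|v| ^+ 2 }.

#[short(type="hilbertType")]
HB.structure Definition Hilbert (R : realType) :=
  {H of CompleteNormedModule R[i] H & hasInnerProduct R H}.

Section Tensor.
Context (R : realType) (H1 H2 H : hilbertType R) (tau : H1 -> H2 -> H).

Definition tensor_sums (A : set H1) (B : set H2) : set H :=
  [set xi | exists (r : nat) (a : 'I_r -> H1) (c : 'I_r -> H2),
     (forall i, A (a i) /\ B (c i)) /\ xi = \sum_(i < r) tau (a i) (c i)].

(* (H, tau) is the Hilbert space tensor product of H1 and H2; these properties
   determine it up to a unique unitary isomorphism. *)
Record hilbert_tensor : Prop := {
  tensor_linearl : forall c, linear (tau^~ c) ;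
  tensor_linearr : forall a, linear (tau a) ;
  tensor_ip : forall a b c d,
    ip (tau a c) (tau b d) = ip a b * ip c d ;
  tensor_dense : closure (tensor_sums setT setT) = setT }.

End Tensor.

Section Representations.
Context (R : realType) (H : hilbertType R).

Definition irreducible_family (I : Type) (A : I -> H -> H) : Prop :=
  (exists v : H, v != 0) /\
  forall V : set H, closed V -> V 0 ->
    (forall (z : R[i]) u v, V u -> V v -> V (z *: u + v)) ->
    (forall i v, V v -> V (A i v)) ->
    V = [set 0] \/ V = setT.

Variable T : topGroupType.

Record unitary_rep (pi : T -> H -> H) : Prop := {
  urep_linear : forall g, linear (pi g) ;
  urep_ip : forall g u v, ip (pi g u) (pi g v) = ip u v ;
  urep1 : forall v, pi 1%g v = v ;
  urepM : forall g h v, pi (g * h)%g v = pi g (pi h v) ;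
  urep_continuous : forall v, continuous (fun g => pi g v) }.

Definition one_parameter (gamma : R -> T) : Prop :=
  continuous gamma /\ forall s t, gamma (s + t) = (gamma s * gamma t)%g.

(* On a Lie group the one-parameter subgroups are the t |-> exp (t X), so this
   says that the iterated derivatives of f of order <= r along left-invariant
   vector fields exist and are continuous. *)
Fixpoint class_C (r : nat) (f : T -> H) : Prop :=
  if r is r'.+1 then
    continuous f /\
    forall gamma, one_parameter gamma -> exists f' : T -> H,
      (forall x, (fun t : R => (t^-1)%:C *: (f (x * gamma t)%g - f x))
                   @ 0^' --> f' x) /\
      class_C r' f'
  else continuous f.

(* Orbit map of class C^oo in the real case, stabilizer open in the p-adic
   case. *)
Definition smooth (k : local_kind) (pi : T -> H -> H) : set H :=
  [set v | match k with
           | RealField => forall r, class_C r (fun g => pi g v)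
           | PadicField => exists2 U : set T, nbhs 1%g U &
                             forall g, U g -> pi g v = v
           end].

End Representations.

Section Symplectic.
Context (F : topFieldType) (N : nat).
Implicit Types (J : 'M[F]_N) (G : set 'M[F]_N).

Definition symplectic_form J : Prop := J^T = - J /\ J \in unitmx.

Definition sform J (u v : 'cV[F]_N) : F := (u^T *m J *m v) 0 0.

Definition Sp J : set 'M[F]_N := [set g | g^T *m J *m g = J].

Definition centralizer J G : set 'M[F]_N :=
  [set g | Sp J g /\ forall h, G h -> g *m h = h *m g].

Definition invariant G (U : {vspace 'cV[F]_N}) : Prop :=
  forall g u, G g -> u \in U -> g *m u \in U.

(* Reductivity in Howe's sense: every invariant subspace of the symplectic
   space has an invariant complement. For the algebraic groups at hand, in
   characteristic 0, this is the same as being a reductive group. *)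
Definition reductive G : Prop :=
  forall U, invariant G U -> exists U', invariant G U' /\
    (U + U' = fullv /\ U :&: U' = 0)%VS.

(* Both members are subgroups of Sp J, being centralizers. *)
Definition dual_reductive_pair J G G' : Prop :=
  [/\ G = centralizer J G', G' = centralizer J G, reductive G & reductive G'].

(* p : T -> GL_N(F) is a finite covering of its image G, which carries the
   subspace topology. *)
Record finite_cover (T : topGroupType) (p : T -> 'M[F]_N) G : Prop := {
  cover_hausdorff : hausdorff_space T ;
  coverM : {morph p : x y / (x * y)%g >-> x *m y} ;
  cover_continuous : continuous p ;
  cover_range : range p = G ;
  cover_open : forall U : set T, open U ->
    exists2 V : set 'M[F]_N, open V & p @` U = G `&` V ;
  cover_finite : finite_set (p @^-1` [set 1%:M]) }.

End Symplectic.

(* (G, G') is G(m), G'(n) in Sp(W1 (+) W2), and G1', G2' are G'(n_1), G'(n_2).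
   G(m) is viewed in Sp(W1) and Sp(W2) through its two diagonal blocks. That
   G'(n_1), G'(n_2) are of the same type as G'(n) is forced: they are the
   centralizers of one group G(m) acting on W1, W2 and W1 (+) W2. *)
Record split_dual_pair (F : topFieldType) (N1 N2 : nat)
    (J1 : 'M[F]_N1) (J2 : 'M[F]_N2)
    (G G' : set 'M[F]_(N1 + N2)) (G1' : set 'M[F]_N1) (G2' : set 'M[F]_N2) :
    Prop := {
  sdp_pair : dual_reductive_pair (block_mx J1 0 0 J2) G G' ;
  sdp_diag : forall g, G g -> g = block_mx (ulsubmx g) 0 0 (drsubmx g) ;
  sdp_inj1 : forall g h, G g -> G h -> ulsubmx g = ulsubmx h -> g = h ;
  sdp_inj2 : forall g h, G g -> G h -> drsubmx g = drsubmx h -> g = h ;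
  sdp_pair1 : dual_reductive_pair J1 [set ulsubmx g | g in G] G1' ;
  sdp_pair2 : dual_reductive_pair J2 [set drsubmx g | g in G] G2' ;
  sdp_sub : forall g1 g2, G1' g1 -> G2' g2 -> G' (block_mx g1 0 0 g2) }.

Section Oscillator.
Context (R : realType) (F : topFieldType) (psi : F -> R[i]) (N : nat)
        (J : 'M[F]_N) (H : hilbertType R).

(* Irreducible unitary representation with central character psi of the
   Heisenberg group, the set W * F with
   (w, s) (w', t) = (w + w', s + t + <w, w'> / 2). *)
Record heisenberg_rep (rho : 'cV[F]_N * F -> H -> H) : Prop := {
  heis_linear : forall h, linear (rho h) ;
  heis_ip : forall h u v, ip (rho h u) (rho h v) = ip u v ;
  heisM : forall w w' s t v,
    rho (w, s) (rho (w', t) v) = rho (w + w', s + t + sform J w w' / 2) v ;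
  heis_center : forall t v, rho (0, t) v = psi t *: v ;
  heis_continuous : forall v, continuous (fun h => rho h v) ;
  heis_irreducible : irreducible_family rho }.

(* p : Mp -> Sp J is the metaplectic double cover and omega its oscillator
   representation: omega implements the action of Sp J on the (unique)
   Heisenberg representation and is genuine. *)
Record oscillator_rep (Mp : topGroupType) (p : Mp -> 'M[F]_N)
    (omega : Mp -> H -> H) : Prop := {
  osc_cover : finite_cover p (Sp J) ;
  osc_unitary : unitary_rep omega ;
  osc_genuine : exists z : Mp, [/\ z != 1%g,
    p @^-1` [set 1%:M] = [set 1%g; z] & forall v, omega z v = - v] ;
  osc_heisenberg : exists2 rho, heisenberg_rep rho &
    forall x w t v, omega x (rho (w, t) v) = rho (p x *m w, t) (omega x v) }.

End Oscillator.

(* tG is a finite cover q of G together with lifts j, j1, j2 of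
   G -> Sp, Sp^(1), Sp^(2) to the metaplectic covers, through which
   omega, omega_1, omega_2 are pulled back to tG. Joint injectivity says that
   tG is no larger than what the metaplectic covers induce. *)
Record induced_cover (F : topFieldType) (N1 N2 : nat)
    (G : set 'M[F]_(N1 + N2)) (Mp Mp1 Mp2 tG : topGroupType)
    (p : Mp -> 'M[F]_(N1 + N2)) (p1 : Mp1 -> 'M[F]_N1) (p2 : Mp2 -> 'M[F]_N2)
    (q : tG -> 'M[F]_(N1 + N2))
    (j : tG -> Mp) (j1 : tG -> Mp1) (j2 : tG -> Mp2) : Prop := {
  ind_cover : finite_cover q G ;
  ind_hom : continuous_hom j ;
  ind_hom1 : continuous_hom j1 ;
  ind_hom2 : continuous_hom j2 ;
  ind_lift : forall y, p (j y) = q y ;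
  ind_lift1 : forall y, p1 (j1 y) = ulsubmx (q y) ;
  ind_lift2 : forall y, p2 (j2 y) = drsubmx (q y) ;
  ind_inj : injective (fun y => (j1 y, j2 y)) }.

(* Main.v *)
From HB Require Import structures.
Require Import Defs.
From mathcomp Require Import all_boot all_order all_algebra.
From mathcomp Require Import finmap complex ring lra.
From mathcomp Require Import all_classical all_reals all_analysis.
From mathcomp Require Import measurable_realfun.
Import numFieldNormedType.Exports.

Set Implicit Arguments.
Unset Strict Implicit.
Unset Printing Implicit Defensive.

Import Order.TTheory GRing.Theory Num.Theory.
Local Open Scope classical_set_scope.
Local Open Scope ring_scope.

(* Writing [xi = sum_i a_i (x) c_i], the integrand is [sum_(i, j) P_ij Q_ij] for
   the matrix coefficients [P_ij] of [omega_1] at the [a_i] and [Q_ij] of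
   [omega_2 (x) pi] at the [c_i (x) u]; both matrices are of positive type and
   square integrable, so the claim is Godement's theorem that two such functions
   have a nonnegative pairing [<P, conj Q>].  Over the reals, let [D_P] be the
   reproducing kernel Hilbert space of [P], a space of functions on the group,
   and [A] the positive operator with [<A f, h>_(D_P) = <f, h>_(L^2)].

   - Replacing the kernel functions [k_x] by [t (t + A)^-1 k_x] makes [A] bounded
     and converges weakly in [L^2] as [t] tends to infinity, so [A] may be taken
     bounded for [P] as well as for [Q].
   - If [Theta : D_P -> D_Q] is defined by [<Theta f, h>_(D_Q) = <f, h>_(L^2)],
     then for a real polynomial [p],
     [<A p(A)^2 P, Q>_(L^2) = |Theta (p(A) delta)|^2 >= 0].  This uses only that
     [Theta] and [A] intertwine translations and that the Haar measure is
     invariant under inversion.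
   - F. Riesz' iteration writes [1] as a sum of polynomials [A p(A)^2] and a
     remainder that vanishes in the limit. *)

(** * Positive semidefinite forms and reproducing kernel Hilbert spaces *)

Section Forms.
Context (R : realType) (V : lmodType R).

Record psd_form (D : set V) (b : V -> V -> R) : Prop := {
  psd_lin : forall (a : R) u v, D u -> D v -> D (a *: u + v) ;
  psd_dom0 : D 0 ;
  psdC : forall u v, D u -> D v -> b u v = b v u ;
  psd_linl : forall (a : R) u v w, D u -> D v -> D w ->
    b (a *: u + v) w = a * b u w + b v w ;
  psd_ge0 : forall u, D u -> 0 <= b u u }.

Definition complete_form (D : set V) (b : V -> V -> R) : Prop :=
  forall u : nat -> V, (forall n, D (u n)) ->
    (forall e, 0 < e -> exists n0, forall m n, (n0 <= m)%N -> (n0 <= n)%N ->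
       b (u m - u n) (u m - u n) <= e) ->
    exists2 v, D v & forall e, 0 < e -> exists n0, forall n, (n0 <= n)%N ->
       b (u n - v) (u n - v) <= e.

Lemma quadratic_ge0 (a c d : R) : 0 <= d ->
  (forall t, 0 <= a + 2 * t * c + t ^+ 2 * d) -> c ^+ 2 <= a * d.
Proof.
rewrite le_eqVlt => /predU1P[<-|d0] H.
  have a0 : 0 <= a by have := H 0; rewrite expr0n /= !(mulr0, mul0r, addr0).
  have [->|c0] := eqVneq c 0; first by rewrite expr0n mulr0.
  have := H (- (a + 1) / (2 * c)).
  have -> : a + 2 * (- (a + 1) / (2 * c)) * c +
      (- (a + 1) / (2 * c)) ^+ 2 * 0 = -1 by field.
  by rewrite ler0N1.
have := H (- c / d).
have -> : a + 2 * (- c / d) * c + (- c / d) ^+ 2 * d = (a * d - c ^+ 2) / d.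
  by field; rewrite gt_eqF.
by rewrite pmulr_lge0 ?invr_gt0// subr_ge0.
Qed.

Variables (D : set V) (b : V -> V -> R).
Hypothesis Db : psd_form D b.

Lemma psd_domD u v : D u -> D v -> D (u + v).
Proof. by move=> Du Dv; rewrite -[u]scale1r; apply: (psd_lin Db). Qed.

Lemma psd_domZ (a : R) u : D u -> D (a *: u).
Proof.
by move=> Du; rewrite -[_ *: _]addr0; apply: (psd_lin Db) => //; exact: psd_dom0 Db.
Qed.

Lemma psd_domB u v : D u -> D v -> D (u - v).
Proof. by move=> Du Dv; rewrite -scaleN1r addrC; apply: (psd_lin Db). Qed.

Lemma psdDl u v w : D u -> D v -> D w -> b (u + v) w = b u w + b v w.
Proof. by move=> *; rewrite -[u]scale1r (psd_linl Db)// mul1r scale1r. Qed.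

Lemma psd0l w : D w -> b 0 w = 0.
Proof.
move=> Dw; have D0 := psd_dom0 Db.
by have := psdDl D0 D0 Dw; rewrite addr0 => /eqP; rewrite -subr_eq0 opprD addNKr oppr_eq0 => /eqP.
Qed.

Lemma psdZl (a : R) u w : D u -> D w -> b (a *: u) w = a * b u w.
Proof.
move=> Du Dw; have D0 := psd_dom0 Db.
by rewrite -[_ *: _]addr0 (psd_linl Db)// psd0l// addr0.
Qed.

Lemma psdBl u v w : D u -> D v -> D w -> b (u - v) w = b u w - b v w.
Proof.
by move=> *; rewrite -scaleN1r addrC (psd_linl Db)// mulN1r addrC.
Qed.

Lemma psdDr u v w : D u -> D v -> D w -> b w (u + v) = b w u + b w v.
Proof.
move=> Du Dv Dw.
by rewrite (psdC Db Dw (psd_domD Du Dv)) psdDl// !(psdC Db Dw).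
Qed.

Lemma psdZr (a : R) u w : D u -> D w -> b w (a *: u) = a * b w u.
Proof.
by move=> Du Dw; rewrite (psdC Db Dw (psd_domZ a Du)) psdZl// (psdC Db Dw).
Qed.

Lemma psdBr u v w : D u -> D v -> D w -> b w (u - v) = b w u - b w v.
Proof.
move=> Du Dv Dw.
by rewrite (psdC Db Dw (psd_domB Du Dv)) psdBl// !(psdC Db Dw).
Qed.

Lemma psd0r w : D w -> b w 0 = 0.
Proof. by move=> Dw; rewrite (psdC Db Dw (psd_dom0 Db)) psd0l. Qed.

Lemma psd_expand (t : R) u v : D u -> D v ->
  b (u + t *: v) (u + t *: v) = b u u + 2 * t * b u v + t ^+ 2 * b v v.
Proof.
move=> Du Dv; have Dt := psd_domZ t Dv; have DD := psd_domD Du Dt.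
rewrite psdDl// !psdDr// !psdZl// !psdZr// (psdC Db Dv Du); ring.
Qed.

Lemma psd_CS u v : D u -> D v -> b u v ^+ 2 <= b u u * b v v.
Proof.
move=> Du Dv; apply: quadratic_ge0 => [|t]; first exact: (psd_ge0 Db).
by rewrite -psd_expand//; apply: (psd_ge0 Db); apply: psd_domD => //; exact: psd_domZ.
Qed.

Lemma psd_sumr (I : Type) (r : seq I) (F : I -> V) w :
  (forall i, D (F i)) -> D w ->
  D (\sum_(i <- r) F i) /\ b w (\sum_(i <- r) F i) = \sum_(i <- r) b w (F i).
Proof.
move=> DF Dw; elim: r => [|i r [DS IH]].
  by rewrite !big_nil psd0r//; split => //; exact: psd_dom0 Db.
by rewrite !big_cons psdDr// IH; split => //; exact: psd_domD.
Qed.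

Lemma psd_suml (I : Type) (r : seq I) (F : I -> V) w :
  (forall i, D (F i)) -> D w ->
  b (\sum_(i <- r) F i) w = \sum_(i <- r) b (F i) w.
Proof.
move=> DF Dw; have [DS E] := psd_sumr r DF Dw.
by rewrite (psdC Db DS Dw) E; apply: eq_bigr => i _; rewrite (psdC Db Dw).
Qed.

Lemma psd_null u v : D u -> D v -> b u u = 0 -> b u v = 0.
Proof.
move=> Du Dv u0; have := psd_CS Du Dv.
by rewrite u0 mul0r real_exprn_even_le0 ?num_real//= => /eqP.
Qed.

Lemma psd_distC u v : D u -> D v -> b (u - v) (u - v) = b (v - u) (v - u).
Proof.
move=> Du Dv; have Dd := psd_domB Du Dv.
by rewrite -(opprB u v) -(scaleN1r (u - v)) psdZl ?psdZr//; [ring|exact: psd_domZ].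
Qed.

Lemma psd_subl_le u v : D u -> D v -> b v v <= 2 * b u u + 2 * b (u - v) (u - v).
Proof.
move=> Du Dv; have := psd_ge0 Db (psd_domD Dv (psd_domZ (-2) Du)).
by rewrite -(scaleN1r v) !psd_expand// (psdC Db Dv Du); lra.
Qed.

(* The representing vector minimizes [b v v - 2 * l v]. *)
Theorem riesz (l : V -> R) (C : R) : 0 <= C -> complete_form D b ->
  (forall (a : R) u v, D u -> D v -> l (a *: u + v) = a * l u + l v) ->
  (forall v, D v -> l v ^+ 2 <= C * b v v) ->
  exists2 v, D v & forall w, D w -> b v w = l w.
Proof.
move=> C0 bc ll lC; pose J v := b v v - 2 * l v.
have JC v : D v -> - C <= J v.
  move=> Dv; have := lC _ Dv; have := psd_ge0 Db Dv; rewrite /J.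
  move: (b v v) (l v) => x y x0 y2.
  have : (2 * y) ^+ 2 <= (x + C) ^+ 2 by have := sqr_ge0 (x - C); nra.
  rewrite -ler_sqrt ?sqr_ge0// !sqrtr_sqr (ger0_norm (addr_ge0 x0 C0)).
  by have := ler_norm (2 * y); lra.
pose A := [set J v | v in D].
have A0 : has_inf A.
  split; first by exists (J 0), 0 => //; exact: psd_dom0 Db.
  by exists (- C) => _ [v Dv <-]; exact: JC.
pose m := inf A.
have mJ v : D v -> m <= J v by move=> Dv; apply: ge_inf; [exact: A0.2|exists v].
have /choice[u Hu] : forall n : nat, exists v, D v /\ J v < m + n.+1%:R^-1.
  move=> n; have n0 : 0 < (n.+1%:R : R)^-1 by rewrite invr_gt0.
  by have [_ [v Dv <-] ?] := inf_adherent n0 A0; exists v.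
have lD v w : D v -> D w -> l (v + w) = l v + l w.
  by move=> Dv Dw; rewrite -[v]scale1r ll// mul1r scale1r.
have l0 : l 0 = 0.
  have D0 := psd_dom0 Db.
  by have := lD 0 0 D0 D0; rewrite addr0; lra.
have lZ (a : R) v : D v -> l (a *: v) = a * l v.
  by move=> Dv; rewrite -[_ *: _]addr0 ll// ?l0 ?addr0//; exact: psd_dom0 Db.
have Ju n w t : D w ->
    0 <= n.+1%:R^-1 + 2 * t * (b (u n) w - l w) + t ^+ 2 * b w w.
  move=> Dw; have [Du Jun] := Hu n.
  have := mJ _ (psd_domD Du (psd_domZ t Dw)).
  rewrite /J psd_expand// lD//; last exact: psd_domZ.
  rewrite lZ//; move: Jun; rewrite /J; set z := _^-1; nra.
have uw n w : D w -> (b (u n) w - l w) ^+ 2 <= n.+1%:R^-1 * b w w.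
  by move=> Dw; apply: quadratic_ge0 => [|t]; [exact: (psd_ge0 Db)|exact: Ju].
have plaw x y : D x -> D y ->
    b (x - y) (x - y) = 2 * J x + 2 * J y - 4 * J (2^-1 *: (x + y)).
  move=> Dx Dy; have Dxy := psd_domD Dx Dy.
  have Dh := psd_domZ 2^-1 Dxy.
  rewrite /J lZ// lD// psdZl// psdZr// psdBl// ?psdBr//; last exact: psd_domB.
  by rewrite psdDl// !psdDr// (psdC Db Dy Dx); field.
have [||v Dv uv] := bc u; first by move=> n; exact: (Hu n).1.
  move=> e e0; pose n0 := Num.trunc (4 / e); exists n0 => k n k0 nn0.
  have inve i : (n0 <= i)%N -> i.+1%:R^-1 <= e / 4.
    move=> i0; rewrite -[leRHS]invrK lef_pV2 ?posrE ?invr_gt0 ?divr_gt0//.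
    rewrite invf_div; apply: le_trans (ltW (truncnS_gt _)) _.
    by rewrite ler_nat ltnS.
  have [Dk Jk] := Hu k; have [Dn Jn] := Hu n.
  rewrite plaw//.
  have := mJ _ (psd_domZ 2^-1 (psd_domD Dk Dn)).
  have := lt_le_trans Jk (lerD (lexx m) (inve _ k0)).
  have := lt_le_trans Jn (lerD (lexx m) (inve _ nn0)); lra.
exists v => // w Dw; apply/eqP; rewrite -subr_eq0 -sqrf_eq0 eq_le sqr_ge0 andbT.
apply/ler_addgt0Pr => e e0; rewrite add0r.
have [w0|w0] := eqVneq (b w w) 0.
  have -> : b v w = 0 by rewrite (psdC Db Dv Dw) psd_null.
  have -> : l w = 0.
    by have := lC _ Dw; rewrite w0 mulr0 real_exprn_even_le0 ?num_real//= => /eqP.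
  by rewrite subr0 expr0n ltW.
have {}w0 : 0 < b w w by rewrite lt_def w0 (psd_ge0 Db Dw).
pose d := e / (4 * b w w).
have d0 : 0 < d by rewrite divr_gt0// mulr_gt0.
have [n0 uvn] := uv _ d0.
pose n := maxn n0 (Num.trunc d^-1).
have [Du _] := Hu n.
have h1 := uw n w Dw; have h2 := uvn n (leq_maxl _ _).
have h3 : n.+1%:R^-1 <= d.
  rewrite -[leRHS]invrK lef_pV2 ?posrE ?invr_gt0//.
  by apply: le_trans (ltW (truncnS_gt _)) _; rewrite ler_nat ltnS leq_maxr.
have h4 := psd_CS (psd_domB Du Dv) Dw.
rewrite psdBl// in h4.
have -> : e = 4 * (d * b w w) by rewrite /d; field; rewrite gt_eqF.
have h5 : n.+1%:R^-1 * b w w <= d * b w w by rewrite ler_wpM2r// ltW.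
have h6 : b (u n - v) (u n - v) * b w w <= d * b w w by rewrite ler_wpM2r// ltW.
have := le_trans h1 h5; have := le_trans h4 h6.
have := sqr_ge0 (b (u n) w - l w + (b (u n) w - b v w)); clear; nra.
Qed.

End Forms.
Lemma additive_bounded_linear (R : realType) (A : R -> R) (M : R) :
  (forall x y, A (x + y) = A x + A y) ->
  (forall x, `|x| <= 1 -> `|A x| <= M) -> forall x, A x = x * A 1.
Proof.
move=> AD AM.
have A0 : A 0 = 0 by have := AD 0 0; rewrite addr0; lra.
pose d x := A x - x * A 1.
have dD x y : d (x + y) = d x + d y by rewrite /d AD; ring.
have dn x (n : nat) : d (n%:R * x) = n%:R * d x.
  elim: n => [|n IH]; first by rewrite !mul0r /d A0 mul0r subr0.
  by rewrite -natr1 !mulrDl !mul1r dD IH.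
have dN x : d (- x) = - d x.
  by have := dD x (- x); rewrite subrr /d A0 mul0r subr0; lra.
have d1 : d 1 = 0 by rewrite /d mul1r subrr.
have dz (z : int) : d z%:~R = 0.
  have dn1 n : d n%:R = 0 by rewrite -[n%:R]mulr1 dn d1 mulr0.
  by case: z => n; rewrite ?NegzE ?rmorphN /= ?dN dn1 ?oppr0.
have M0 : 0 <= M by apply: le_trans (AM 0 _); rewrite ?normr0.
have dM x : `|d x| <= 2 * M.
  have -> : d x = d (x - (Num.floor x)%:~R).
    by rewrite dD dN dz oppr0 addr0.
  set y := x - _.
  have /andP[y0 y1] : 0 <= y <= 1.
    have := floor_le_tmp x; have := floorD1_gt x.
    by rewrite intrD1 /y; lra.
  have y2 : `|y| <= 1 by rewrite ger0_norm.
  have A1 : `|A 1| <= M by apply: AM; rewrite normr1.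
  apply: le_trans (ler_normB _ _) _; rewrite normrM.
  have := AM _ y2; have := normr_ge0 (A 1); have := normr_ge0 y; nra.
move=> x; apply/eqP; rewrite -subr_eq0; apply/negPn/negP => dx.
have {}dx : 0 < `|d x| by rewrite normr_gt0.
pose n := (Num.trunc (2 * M / `|d x|)).+1.
have := dM (n%:R * x).
rewrite dn normrM ger0_norm// leNgt -ltr_pdivrMr// => /negP; apply.
exact: truncnS_gt.
Qed.

Section JordanVonNeumann.
Context (R : realType) (V : lmodType R) (D : set V) (N : V -> R).

Definition polar_form (u v : V) : R := (N (u + v) - N (u - v)) / 4.

Hypotheses (D0 : D 0) (DD : forall u v, D u -> D v -> D (u + v))
  (DZ : forall (c : R) u, D u -> D (c *: u))
  (N_ge0 : forall u, D u -> 0 <= N u)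
  (NZ : forall (c : R) u, D u -> N (c *: u) = c ^+ 2 * N u)
  (N_parallelogram_le : forall u v, D u -> D v ->
     N (u + v) + N (u - v) <= 2 * N u + 2 * N v).

Let DB u v : D u -> D v -> D (u - v).
Proof. by move=> Du Dv; apply: DD => //; rewrite -scaleN1r; exact: DZ. Qed.

Let NN u : D u -> N (- u) = N u.
Proof. by move=> Du; rewrite -scaleN1r NZ// sqrrN expr1n mul1r. Qed.

Let N0 : N 0 = 0.
Proof. by rewrite -(scale0r 0) NZ// expr0n mul0r. Qed.

Let parallelogram u v : D u -> D v ->
  N (u + v) + N (u - v) = 2 * N u + 2 * N v.
Proof.
move=> Du Dv; apply/eqP; rewrite eq_le N_parallelogram_le//=.
have := N_parallelogram_le (DD Du Dv) (DB Du Dv).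
have -> : u + v + (u - v) = (2 : R) *: u.
  by rewrite scaler_nat mulr2n addrACA subrr addr0.
have -> : u + v - (u - v) = (2 : R) *: v.
  by rewrite scaler_nat mulr2n opprB [v - u]addrC addrACA subrr add0r.
by rewrite !NZ//; lra.
Qed.

Let formC u v : D u -> D v -> polar_form u v = polar_form v u.
Proof.
move=> Du Dv; rewrite /polar_form [v + u]addrC -[u - v]opprB NN//.
exact: DB.
Qed.

Let formDl u v w : D u -> D v -> D w ->
  polar_form (u + v) w = polar_form u w + polar_form v w.
Proof.
have half x y z : D x -> D y -> D z ->
    2 * (polar_form x z + polar_form y z) = polar_form (x + y) ((2 : R) *: z).
  move=> Dx Dy Dz.
  have := parallelogram (DD Dx Dz) (DD Dy Dz).
  have := parallelogram (DB Dx Dz) (DB Dy Dz).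
  have -> : x - z + (y - z) = x + y - (2 : R) *: z.
    by rewrite addrACA -opprD scaler_nat mulr2n.
  have -> : x + z + (y + z) = x + y + (2 : R) *: z.
    by rewrite addrACA scaler_nat mulr2n.
  have -> : x - z - (y - z) = x - y by rewrite opprB addrA subrK.
  have -> : x + z - (y + z) = x - y by rewrite opprD addrACA subrr addr0.
  by rewrite /polar_form; lra.
move=> Du Dv Dw.
have w0 : polar_form 0 w = 0.
  by rewrite /polar_form add0r sub0r NN// subrr mul0r.
have := half _ _ _ (DD Du Dv) D0 Dw; have := half _ _ _ Du Dv Dw.
by rewrite addr0 w0; lra.
Qed.

Let formZl (c : R) u v : D u -> D v -> polar_form (c *: u) v = c * polar_form u v.
Proof.
move=> Du Dv; rewrite -[in RHS](scale1r u).
pose M := (N u + N v) / 2.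
apply: (@additive_bounded_linear R (fun c => polar_form (c *: u) v) M).
  by move=> x y; rewrite scalerDl formDl//; exact: DZ.
move=> x x1; have Dx := DZ x Du; have := parallelogram Dx Dv.
rewrite NZ//; have := N_ge0 (DD Dx Dv).
have := N_ge0 (DB Dx Dv) => n1 n2 E.
have x2 : x ^+ 2 <= 1 by rewrite -real_normK ?num_real// expr_le1.
have x3 : x ^+ 2 * N u <= N u by rewrite ler_piMl ?N_ge0.
by rewrite /polar_form /M ler_norml; apply/andP; split; lra.
Qed.

Lemma polar_formE u : D u -> polar_form u u = N u.
Proof.
move=> Du; rewrite /polar_form subrr N0 subr0.
have -> : u + u = (2 : R) *: u by rewrite scaler_nat mulr2n.
by rewrite NZ//; field.
Qed.

Lemma polar_form_psd : psd_form D polar_form.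
Proof.
split=> //.
- by move=> a u v Du Dv; apply: DD => //; exact: DZ.
- by move=> a u v w Du Dv Dw; rewrite formDl ?formZl//; exact: DZ.
- by move=> u Du; rewrite polar_formE// N_ge0.
Qed.

End JordanVonNeumann.

Section RKHS.
Context (R : realType) (X : Type).
Implicit Types (f g : X -> R^o) (s : seq (R * X)).

Definition ev s f : R := \sum_(p <- s) p.1 * f p.2.
Definition scale_seq (c : R) s := [seq (c * p.1, p.2) | p <- s].

Lemma ev_cat s s' f : ev (s ++ s') f = ev s f + ev s' f.
Proof. by rewrite /ev big_cat. Qed.

Lemma ev_scale c s f : ev (scale_seq c s) f = c * ev s f.
Proof. by rewrite /ev big_map mulr_sumr; apply: eq_bigr => p _; rewrite mulrA. Qed.

Lemma evD s f g : ev s (f + g) = ev s f + ev s g.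
Proof. by rewrite /ev -big_split; apply: eq_bigr => p _; rewrite /= mulrDr. Qed.

Lemma evZ s (c : R) f : ev s (c *: f) = c * ev s f.
Proof. by rewrite /ev mulr_sumr; apply: eq_bigr => p _ /=; rewrite mulrCA. Qed.

Lemma evB s f g : ev s (f - g) = ev s f - ev s g.
Proof. by rewrite -scaleN1r evD evZ mulN1r. Qed.

Variable k : X -> X -> R.

Definition ksum s : X -> R^o := fun y => \sum_(p <- s) p.1 * k p.2 y.

Record psd_kernel : Prop := {
  kernelC : forall x y, k x y = k y x ;
  kernel_ge0 : forall s, 0 <= ev s (ksum s) }.

Lemma ksum_cat s s' : ksum (s ++ s') = ksum s + ksum s'.
Proof. by apply/funext => y; rewrite /ksum big_cat. Qed.

Lemma ksum_scale c s : ksum (scale_seq c s) = c *: ksum s.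
Proof.
apply/funext => y; transitivity (c * ksum s y) => //.
rewrite /ksum big_map mulr_sumr.
by apply: eq_bigr => p _; rewrite mulrA.
Qed.

Lemma ksum_nil : ksum [::] = 0.
Proof. by apply/funext => y; rewrite /ksum big_nil. Qed.

Lemma ksum_cons p s : ksum (p :: s) = p.1 *: (k p.2 : X -> R^o) + ksum s.
Proof. by apply/funext => y; rewrite /ksum big_cons. Qed.

Lemma ksum1 x : ksum [:: (1, x)] = k x.
Proof. by apply/funext => y; rewrite /ksum big_seq1 mul1r. Qed.

Hypothesis kP : psd_kernel.

Let Q s := ev s (ksum s).

Lemma ev_ksumC s s' : ev s (ksum s') = ev s' (ksum s).
Proof.
rewrite /ev /ksum; under eq_bigr do rewrite mulr_sumr.
rewrite exchange_big; apply: eq_bigr => p _; rewrite mulr_sumr.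
by apply: eq_bigr => q _; rewrite (kernelC kP) mulrCA.
Qed.

Let Q_cat c s s' : Q (s ++ scale_seq c s') = Q s + 2 * c * ev s (ksum s') + c ^+ 2 * Q s'.
Proof.
rewrite /Q ksum_cat ksum_scale !(ev_cat, evD, ev_scale, evZ) (ev_ksumC s' s); ring.
Qed.

Let Q_scale c s : Q (scale_seq c s) = c ^+ 2 * Q s.
Proof. by rewrite /Q ksum_scale ev_scale evZ mulrA. Qed.

Let A f := [set 2 * ev s f - Q s | s in setT].

(* By duality, the squared norm of [f] is the supremum of
   [2 <f, K s> - |K s|^2] over the combinations [K s] of kernel functions. *)
Definition rkhs : set (X -> R^o) := [set f | has_ubound (A f)].
Definition rk_sqnorm f : R := sup (A f).
Definition rk_form : (X -> R^o) -> (X -> R^o) -> R := polar_form rk_sqnorm.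

Lemma rk_sqnorm_ub f s : rkhs f -> 2 * ev s f - Q s <= rk_sqnorm f.
Proof. by move=> Df; apply: ub_le_sup => //; exists s. Qed.

Lemma rk_sqnorm_le f c : (forall s, 2 * ev s f - Q s <= c) ->
  rkhs f /\ rk_sqnorm f <= c.
Proof.
move=> H; split; first by exists c => _ [s _ <-].
by apply: ge_sup => [|_ [s _ <-]//]; exists (2 * ev [::] f - Q [::]), [::].
Qed.

Lemma rk_sqnorm_ge0 f : rkhs f -> 0 <= rk_sqnorm f.
Proof.
by move=> /(rk_sqnorm_ub [::]); rewrite /Q /ev !big_nil mulr0 subr0.
Qed.

Let sqnormZ_le c f : c != 0 -> rkhs f ->
  rkhs (c *: f) /\ rk_sqnorm (c *: f) <= c ^+ 2 * rk_sqnorm f.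
Proof.
move=> c0 Df; apply: rk_sqnorm_le => s.
have := rk_sqnorm_ub (scale_seq c^-1 s) Df; rewrite Q_scale ev_scale evZ.
rewrite -(ler_pM2l (_ : 0 < c ^+ 2)) ?exprn_even_gt0//.
by apply: le_trans; rewrite le_eqVlt; apply/orP; left; apply/eqP; field.
Qed.

Let rkhs0 : rkhs 0 /\ rk_sqnorm 0 = 0.
Proof.
have [D0 N0] : rkhs 0 /\ rk_sqnorm 0 <= 0.
  apply: rk_sqnorm_le => s; have -> : ev s 0 = 0.
    by rewrite /ev big1// => p _; rewrite mulr0.
  by rewrite mulr0 add0r oppr_le0; exact: (kernel_ge0 kP).
by split => //; apply/eqP; rewrite eq_le N0 rk_sqnorm_ge0.
Qed.

Let sqnormZ c f : rkhs f ->
  rkhs (c *: f) /\ rk_sqnorm (c *: f) = c ^+ 2 * rk_sqnorm f.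
Proof.
move=> Df; have [->|c0] := eqVneq c 0.
  by rewrite scale0r expr0n mul0r.
have [Dc Nc] := sqnormZ_le c0 Df; split => //; apply/eqP; rewrite eq_le Nc /=.
have c1 : c^-1 != 0 by rewrite invr_eq0.
have [_] := sqnormZ_le c1 Dc; rewrite scalerA mulVf// scale1r.
rewrite -(ler_pM2l (_ : 0 < c ^+ 2)) ?exprn_even_gt0//.
by rewrite mulrA -exprMn mulfV// expr1n mul1r.
Qed.

Let rkhsD f g : rkhs f -> rkhs g -> rkhs (f + g).
Proof.
move=> Df Dg; have [D2f _] := sqnormZ 2 Df; have [D2g _] := sqnormZ 2 Dg.
have [|//] := @rk_sqnorm_le (f + g) ((rk_sqnorm (2 *: f) + rk_sqnorm (2 *: g)) / 2).
move=> s; have := rk_sqnorm_ub s D2f; have := rk_sqnorm_ub s D2g.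
by rewrite evD !evZ; lra.
Qed.

Let rkhsB f g : rkhs f -> rkhs g -> rkhs (f - g).
Proof. by move=> Df Dg; apply: rkhsD => //; rewrite -scaleN1r; case: (sqnormZ (-1) Dg). Qed.

Let parallelogram_le f g : rkhs f -> rkhs g ->
  rk_sqnorm (f + g) + rk_sqnorm (f - g) <= 2 * rk_sqnorm f + 2 * rk_sqnorm g.
Proof.
move=> Df Dg; have [D2f N2f] := sqnormZ 2 Df; have [D2g N2g] := sqnormZ 2 Dg.
rewrite -lerBrDr; apply: (rk_sqnorm_le _).2 => s.
rewrite lerBrDr -lerBrDl; apply: (rk_sqnorm_le _).2 => s'.
have := rk_sqnorm_ub (s ++ scale_seq 1 s') D2f.
have := rk_sqnorm_ub (s ++ scale_seq (-1) s') D2g.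
rewrite N2f N2g !Q_cat !ev_cat !ev_scale !evZ evB evD; lra.
Qed.

Lemma rk_formE f : rkhs f -> rk_form f f = rk_sqnorm f.
Proof. exact: (polar_formE rkhs0.1 (fun c f Df => (sqnormZ c Df).2)). Qed.

Lemma rk_form_psd : psd_form rkhs rk_form.
Proof.
apply: polar_form_psd; [exact: rkhs0.1|exact: rkhsD| | | |exact: parallelogram_le].
- by move=> c u /(sqnormZ c)[].
- exact: rk_sqnorm_ge0.
- by move=> c u /(sqnormZ c)[].
Qed.

Let sqnorm_shift f s : rkhs f -> rkhs (f + ksum s) /\
  rk_sqnorm (f + ksum s) = rk_sqnorm f + 2 * ev s f + Q s.
Proof.
have le g t : rkhs g -> rkhs (g + ksum t) /\
    rk_sqnorm (g + ksum t) <= rk_sqnorm g + 2 * ev t g + Q t.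
  move=> Dg; apply: rk_sqnorm_le => u.
  have := rk_sqnorm_ub (u ++ scale_seq (-1) t) Dg.
  by rewrite Q_cat ev_cat ev_scale evD; lra.
move=> Df; have [D1 N1] := le f s Df; split => //; apply/eqP; rewrite eq_le N1/=.
have [_] := le _ (scale_seq (-1) s) D1.
rewrite ksum_scale scaleN1r addrK Q_scale ev_scale evD -/(Q s); lra.
Qed.

Lemma rkhs_ksum s : rkhs (ksum s).
Proof. by have [] := sqnorm_shift s rkhs0.1; rewrite add0r. Qed.

Lemma rk_form_ksum f s : rkhs f -> rk_form f (ksum s) = ev s f.
Proof.
move=> Df; rewrite /rk_form /polar_form (sqnorm_shift s Df).2.
have [_] := sqnorm_shift (scale_seq (-1) s) Df.
by rewrite ksum_scale scaleN1r => ->; rewrite Q_scale ev_scale; field.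
Qed.

Lemma rkhs_kernel x : rkhs (k x).
Proof. by rewrite -ksum1; exact: rkhs_ksum. Qed.

Lemma rk_form_kernel f x : rkhs f -> rk_form f (k x) = f x.
Proof. by move=> Df; rewrite -ksum1 rk_form_ksum// /ev big_seq1 mul1r. Qed.

Lemma rkhs_eval f x : rkhs f -> f x ^+ 2 <= rk_form f f * k x x.
Proof.
move=> Df; have Dx := rkhs_kernel x; rewrite -[f x]rk_form_kernel//.
by have := psd_CS rk_form_psd Df Dx; rewrite (rk_form_kernel x Dx).
Qed.

Lemma rkhs_definite f : rkhs f -> rk_form f f = 0 -> f = 0.
Proof.
move=> Df f0; apply/funext => x; have := rkhs_eval x Df.
by rewrite f0 mul0r real_exprn_even_le0 ?num_real//= => /eqP.
Qed.

Lemma rkhs_complete_pointwise (u : nat -> X -> R^o) f : (forall n, rkhs (u n)) ->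
  (forall e, 0 < e -> exists n0, forall m n, (n0 <= m)%N -> (n0 <= n)%N ->
    rk_form (u m - u n) (u m - u n) <= e) ->
  (forall x, (fun n => u n x) @ \oo --> f x) ->
  rkhs f /\ forall e, 0 < e -> exists n0, forall n, (n0 <= n)%N ->
    rk_form (u n - f) (u n - f) <= e.
Proof.
move=> Du uC uf.
have evf s : (fun n => ev s (u n)) @ \oo --> ev s f.
  elim: s => [|p s IH]; first by rewrite /ev big_nil;
    under eq_fun do rewrite big_nil; exact: cvg_cst.
  rewrite /ev big_cons; under eq_fun do rewrite big_cons.
  by apply: cvgD IH; apply: cvgM; [exact: cvg_cst|exact: uf].
have step e : 0 < e -> exists n0, forall n, (n0 <= n)%N ->
    rkhs (u n - f) /\ rk_sqnorm (u n - f) <= e.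
  move=> /uC[n0 Hn]; exists n0 => n nn0; apply: rk_sqnorm_le => s.
  have cv : (fun m => 2 * (ev s (u n) - ev s (u m)) - Q s) @ \oo -->
      2 * ev s (u n - f) - Q s.
    rewrite evB.
    apply: cvgB; last exact: cvg_cst.
    by apply: cvgM; [|apply: cvgB; last exact: evf]; exact: cvg_cst.
  have <- := cvg_lim (@Rhausdorff R) cv; apply: limr_le; first by apply: cvgP cv.
  exists n0 => // m /= mn0; apply: le_trans (Hn n m nn0 mn0).
  have D : rkhs (u n - u m) by apply: rkhsB.
  rewrite rk_formE//; apply: le_trans (rk_sqnorm_ub s D).
  by rewrite evB.
have Df : rkhs f.
  have [n0 /(_ _ (leqnn _))[D _]] := step 1 ltr01.
  by have := rkhsB (Du n0) D; rewrite subKr.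
split => // e /step[n0 Hn]; exists n0 => n /Hn[D N].
by rewrite rk_formE.
Qed.

Lemma rk_form_complete : complete_form rkhs rk_form.
Proof.
move=> u Du uC.
have /choice[f uf] : forall x, exists l : R, (fun n => u n x) @ \oo --> l.
  move=> x; apply/cvg_ex; apply/cauchy_cvgP; apply: cauchy_exP => e e0.
  pose K := k x x + 1.
  have kx0 : 0 <= k x x.
    have Dx := rkhs_kernel x.
    by have := psd_ge0 rk_form_psd Dx; rewrite rk_form_kernel.
  have K0 : 0 < K by rewrite ltr_wpDl.
  have [|n0 Hn] := uC (e ^+ 2 / (2 * K)).
    by rewrite divr_gt0 ?exprn_gt0// mulr_gt0.
  exists (u n0 x); exists n0 => // n /= nn0; rewrite /ball /=.
  have D : rkhs (u n0 - u n) by apply: rkhsB.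
  have := rkhs_eval x D; have := Hn n0 n (leqnn _) nn0.
  set F := rk_form _ _ => FK.
  have F0 : 0 <= F by exact: (psd_ge0 rk_form_psd).
  have -> : (u n0 - u n) x = u n0 x - u n x by [].
  move=> H; have : `|u n0 x - u n x| ^+ 2 < e ^+ 2.
    rewrite real_normK ?num_real//; apply: le_lt_trans H _.
    have : F * k x x <= e ^+ 2 / (2 * K) * K.
      by apply: ler_pM => //; rewrite /K lerDl.
    have -> : e ^+ 2 / (2 * K) * K = e ^+ 2 / 2 by field; rewrite gt_eqF.
    by have := exprn_gt0 2 e0; lra.
  by rewrite ltr_pXn2r ?nnegrE// ltW.
have [Df Hf] := rkhs_complete_pointwise Du uC uf.
by exists f.
Qed.

Lemma rkhs_cvg_pointwise (u : nat -> X -> R^o) f x : (forall n, rkhs (u n)) ->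
  rkhs f -> (forall e, 0 < e -> exists n0, forall n, (n0 <= n)%N ->
    rk_form (u n - f) (u n - f) <= e) ->
  (fun n => u n x) @ \oo --> f x.
Proof.
move=> Du Df uf; apply/cvgrPdist_le => e e0.
have kx0 : 0 <= k x x.
  by rewrite -(rk_form_kernel x (rkhs_kernel x)); apply: (psd_ge0 rk_form_psd); exact: rkhs_kernel.
have K0 : 0 < k x x + 1 by rewrite ltr_wpDl.
have [|n0 Hn] := uf (e ^+ 2 / (k x x + 1)); first by rewrite divr_gt0// exprn_gt0.
exists n0 => // n /= /Hn {}Hn; rewrite distrC -ler_sqr ?nnegrE ?(ltW e0)//.
rewrite real_normK ?num_real//; have Dd := psd_domB rk_form_psd (Du n) Df.
apply: le_trans (rkhs_eval x Dd) _.
apply: le_trans (ler_wpM2r kx0 Hn) _.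
by rewrite mulrAC ler_pdivrMr// ler_wpM2l ?sqr_ge0// lerDl.
Qed.

Lemma rkhs_dense f e : rkhs f -> 0 < e ->
  exists s, rk_form (f - ksum s) (f - ksum s) < e.
Proof.
move=> Df e0; have hs : has_sup (A f) by split => //; exists (2 * ev [::] f - Q [::]), [::].
have [_ [s _ <-] Hs] := sup_adherent e0 hs; exists s.
have Dm : rkhs (f - ksum s) by apply: rkhsB => //; exact: rkhs_ksum.
rewrite rk_formE//; have [_] := sqnorm_shift (scale_seq (-1) s) Df.
rewrite ksum_scale scaleN1r => ->; rewrite Q_scale ev_scale; move: Hs.
by rewrite -/(rk_sqnorm f); lra.
Qed.

Lemma rkhs_comp (t t' : X -> X) f g : cancel t' t ->
  (forall x y, k (t x) (t y) = k x y) -> rkhs f -> rkhs g ->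
  rkhs (f \o t : X -> R^o) /\ rk_form (f \o t : X -> R^o) (g \o t) = rk_form f g.
Proof.
move=> tK kt.
have ks s : Q [seq (p.1, t p.2) | p <- s] = Q s.
  rewrite /Q /ev /ksum !big_map; apply: eq_bigr => p _ /=; congr (_ * _).
  by rewrite !big_map; apply: eq_bigr => q _; rewrite kt.
have es s h : ev [seq (p.1, t p.2) | p <- s] h = ev s (h \o t : X -> R^o).
  by rewrite /ev big_map.
have AE h : A (h \o t : X -> R^o) = A h.
  apply/seteqP; split=> _ [s _ <-].
    by exists [seq (p.1, t p.2) | p <- s] => //; rewrite ks es.
  exists [seq (p.1, t' p.2) | p <- s] => //.
  rewrite -ks -es -map_comp (_ : map _ s = s)//.
  by rewrite -[RHS]map_id; apply: eq_map => -[a x] /=; rewrite tK.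
move=> Df Dg; rewrite /rkhs /= AE; split => //.
by rewrite /rk_form /polar_form /rk_sqnorm -[in RHS](AE (f + g)) -[in RHS](AE (f - g)).
Qed.

End RKHS.
(** * Haar measure: Tonelli's theorem and invariance under inversion *)

(* [compact_cover] applies to pointed spaces only. *)
HB.instance Definition _ (T U : ptopologicalType) :=
  Topological.on (T * U)%type.

Lemma open_rectangle (T U : topologicalType) (A : set T) (B : set U) :
  open A -> open B -> open (A `*` B).
Proof.
move=> oA oB; apply: openI.
  by apply: (@open_comp _ _ (fun z : T * U => z.1)) => // z _; exact: cvg_fst.
by apply: (@open_comp _ _ (fun z : T * U => z.2)) => // z _; exact: cvg_snd.
Qed.

Section Borel.
Context (R : realType) (G : topGroupType).

Lemma measurable_open (U : set G) : open U -> measurable (U : set (borel G)).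
Proof. by move=> oU; exact: sub_sigma_algebra. Qed.

Lemma measurable_closed (C : set G) : closed C -> measurable (C : set (borel G)).
Proof.
by move=> cC; rewrite -[C]setCK; apply: measurableC; apply: measurable_open; exact: closed_openC.
Qed.

Lemma continuous_borel_fun (f : G -> R) : continuous f ->
  measurable_fun [set: borel G] (f : borel G -> R).
Proof.
move=> cf; apply: (measurability _ (RGenOInfty.measurableE R)) => _ [_ [x ->] <-].
rewrite setTI; apply: measurable_open.
by rewrite set_itvE; apply: open_comp; [move=> ? _; exact: cf|exact: open_gt].
Qed.

Lemma continuous_borel (f : G -> G) : continuous f ->
  measurable_fun [set: borel G] (f : borel G -> borel G).
Proof.
move=> cf; apply: (@measurability _ _ (borel G) (borel G) setT f
  (@open G : set (set (borel G)))) => // _ [U oU <-].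
by rewrite setTI; apply: measurable_open; apply: open_comp => // ? _; exact: cf.
Qed.

Lemma continuous_mull (h : G) : continuous (fun g : G => (h * g)%g).
Proof.
move=> g; apply: (@continuous_comp _ _ _ (fun g => (h, g)) (fun z => (z.1 * z.2)%g)).
  by apply: cvg_pair; [exact: cvg_cst|exact: cvg_id].
exact: mulg_continuous.
Qed.

Lemma continuous_mulr (h : G) : continuous (fun g : G => (g * h)%g).
Proof.
move=> g; apply: (@continuous_comp _ _ _ (fun g => (g, h)) (fun z => (z.1 * z.2)%g)).
  by apply: cvg_pair; [exact: cvg_id|exact: cvg_cst].
exact: mulg_continuous.
Qed.

(* The Borel sigma-algebra of [G * G] may be larger than the product of the
   Borel sigma-algebras; on compact rectangles open sets are approximated from
   inside by finite unions of open rectangles. *)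
Lemma measurable_fun_compact_rectangle (F : G * G -> R) (K K' : set G) :
  hausdorff_space G -> compact K -> compact K' -> continuous F ->
  measurable_fun [set: borel G * borel G]
    (fun z : borel G * borel G => \1_(K `*` K') z * F z).
Proof.
move=> hG cK cK' cF.
have mK : measurable (K : set (borel G)) by apply: measurable_closed; exact: compact_closed.
have mK' : measurable (K' : set (borel G)) by apply: measurable_closed; exact: compact_closed.
have mKK : measurable ((K `*` K') : set (borel G * borel G)) by exact: measurableX.
have cKK := compact_setX cK cK'.
have open_rect (O : set (G * G)) : open O -> forall L : set (G * G), compact L ->
    L `<=` O -> exists2 W : set (borel G * borel G), measurable W &
      L `<=` W /\ W `<=` O.
  move=> oO L cL LO.
  have : forall z, exists A : set G * set G,
      [/\ open A.1, open A.2, L z -> (A.1 `*` A.2) z & A.1 `*` A.2 `<=` O].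
    move=> z; have [Lz|nLz] := pselect (L z); last first.
      by exists (set0, set0); split => //=; [exact: open0|exact: open0|move=> ? []].
    have /(_ z (LO _ Lz)) := oO.
    rewrite openE in oO; have := oO z (LO _ Lz).
    move=> [[A B] [/= /nbhs_interior An /nbhs_interior Bn] AB] _.
    exists (A^°, B^°); split => /=; [exact: open_interior|exact: open_interior| |].
      by move=> _; split; exact: nbhs_singleton.
    by apply: subset_trans AB => -[a b] [/= /interior_subset ? /interior_subset ?].
  move=> /choice[A HA].
  have : cover_compact L by move: cL; rewrite compact_cover.
  move=> /(_ _ setT (fun z => (A z).1 `*` (A z).2)); case.
  - by move=> z _; have [A1 A2 _ _] := HA z; exact: open_rectangle.
  - by move=> z Lz; exists z => //; have [_ _ zA _] := HA z; exact: zA.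
  move=> D' _ LD; exists (\bigcup_(z in [set` D']) ((A z).1 `*` (A z).2)).
    apply: fin_bigcup_measurable => // z _.
    by have [A1 A2 _ _] := HA z; apply: measurableX; exact: measurable_open.
  by split => // z [i _ Az]; have [_ _ _ AO] := HA i; exact: AO.
have mF t : measurable ((K `*` K') `&` [set z | t < F z] : set (borel G * borel G)).
  have /choice[W HW] : forall n : nat, exists W : set (borel G * borel G),
      measurable W /\ ((K `*` K') `&` [set z : G * G | t + n.+1%:R^-1 <= F z] `<=` W
        /\ W `<=` [set z : G * G | t < F z]).
    move=> n.
    have [|||W mW HW] := open_rect [set z : G * G | t < F z] _
        ((K `*` K') `&` [set z : G * G | t + n.+1%:R^-1 <= F z]).
    - by apply: (@open_comp _ _ F [set y | t < y]); [move=> ? _; exact: cF|exact: open_gt].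
    - apply: (subclosed_compact _ cKK); last exact: subIsetl.
      apply: closedI; first apply: closedI.
      + apply: (@closed_comp _ _ (fun z : G * G => z.1)); last exact: compact_closed.
        by move=> z _; exact: cvg_fst.
      + apply: (@closed_comp _ _ (fun z : G * G => z.2)); last exact: compact_closed.
        by move=> z _; exact: cvg_snd.
      + by apply: (@closed_comp _ _ F [set y | _ <= y]); [move=> ? _; exact: cF|exact: closed_ge].
    - by move=> z [_ /=]; apply: lt_le_trans; rewrite ltrDl invr_gt0.
    by exists W.
  rewrite (_ : _ `&` _ = (K `*` K') `&` \bigcup_n W n).
    by apply: measurableI => //; apply: bigcup_measurable => n _; exact: (HW n).1.
  apply/seteqP; split => z [Kz Hz]; split => //=; last first.
    by have [n _ Wz] := Hz; have [_ [_ WF]] := HW n; exact: WF.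
  pose n := Num.trunc (F z - t)^-1; exists n => //.
  have [_ [KW _]] := HW n; apply: KW; split => //=.
  rewrite -lerBrDl -[leRHS]invrK lef_pV2 ?posrE ?invr_gt0 ?subr_gt0//.
  exact/ltW/truncnS_gt.
have mF' : measurable_fun (K `*` K' : set (borel G * borel G)) F.
  move=> _; apply: (measurability _ (RGenOInfty.measurableE R)) => // _ [_ [x ->] <-].
  rewrite (_ : _ @^-1` _ = [set z | x < F z]); first exact: mF.
  by apply/seteqP; split => z /=; rewrite in_itv/= andbT.
have := (measurable_restrictT (F : borel G * borel G -> R) mKK).1 mF'.
apply: eq_measurable_fun => z _; rewrite /patch indicE.
by case: (z \in K `*` K'); rewrite ?mul1r ?mul0r.
Qed.
End Borel.

Section HaarIntegral.
Context (R : realType) (G : topGroupType)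
  (mu : {measure set (borel G) -> \bar R}).

Lemma ge0_le_integral_nonmeas (d : measure_display) (T : measurableType d)
  (nu : {measure set T -> \bar R}) (D : set T) (f g : T -> \bar R) :
  (forall x, D x -> (0 <= f x)%E) -> (forall x, D x -> (f x <= g x)%E) ->
  (\int[nu]_(x in D) f x <= \int[nu]_(x in D) g x)%E.
Proof.
move=> f0 fg; rewrite !ge0_integralE//; last first.
  by move=> x Dx; apply: le_trans (f0 _ Dx) (fg _ Dx).
apply: le_ereal_sup => _ [s sf <-]; exists s => // x.
apply: le_trans (sf x) _; rewrite /patch; case: ifPn => // /set_mem; exact: fg.
Qed.

Hypothesis hausG : hausdorff_space G.
Hypothesis mu_haar : haar_measure mu.

Lemma haar_tonelli_compact (K K' : set G) (F : G -> G -> R) :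
  compact K -> compact K' -> continuous (fun z : G * G => F z.1 z.2) ->
  (forall x y, 0 <= F x y) ->
  (\int[mu]_(x in K) \int[mu]_(y in K') (F x y)%:E =
   \int[mu]_(y in K') \int[mu]_(x in K) (F x y)%:E)%E.
Proof.
move=> cK cK' cF F0.
have mK : measurable (K : set (borel G)) by apply: measurable_closed; exact: compact_closed.
have mK' : measurable (K' : set (borel G)) by apply: measurable_closed; exact: compact_closed.
have restrE (L : set (borel G)) (mL : measurable L) (Loo : (mu L < +oo)%E)
    (f : borel G -> \bar R) : (forall x, ~ L x -> f x = 0%E) ->
    (\int[mfrestr mL Loo]_x f x = \int[mu]_(x in L) f x)%E.
  move=> f0; rewrite [RHS]integral_mkcond.
  have -> : f \_ L = f.
    apply/funext => x; rewrite /patch; case: ifPn => // /negP xL.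
    by rewrite f0// => Lx; apply: xL; rewrite inE.
  have -> : f = f \_ L.
    apply/funext => x; rewrite /patch; case: ifPn => // /negP xL.
    by rewrite f0// => Lx; apply: xL; rewrite inE.
  rewrite -!integral_mkcond; apply: eq_measure_integral => A mA AL.
  by rewrite /= /mfrestr /mrestr setIidl.
have Koo := haar_compact_fin mu_haar.1 cK.
have Koo' := haar_compact_fin mu_haar.1 cK'.
pose f (z : borel G * borel G) : \bar R := (\1_(K `*` K') z * F z.1 z.2)%:E.
have mf : @measurable_fun _ _ (borel G * borel G)%type (\bar R) setT f.
  apply/measurable_EFinP.
  exact: (measurable_fun_compact_rectangle hausG cK cK' cF).
have f0 z : (0 <= f z)%E by rewrite lee_fin mulr_ge0.
have := @fubini_tonelli _ _ _ _ R (mfrestr mK Koo) (mfrestr mK' Koo') f mf f0.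
have fK x y : ~ (K x /\ K' y) -> f (x, y) = 0%E.
  by move=> H; rewrite /f indicE memNset ?mul0r.
have fE x y : K x -> K' y -> f (x, y) = (F x y)%:E.
  by move=> Kx Ky; rewrite /f indicE mem_set ?mul1r.
rewrite !restrE; last 2 first.
- move=> y nK; apply: integral0_eq => x _; apply: fK; tauto.
- move=> x nK; apply: integral0_eq => y _; apply: fK; tauto.
move=> E; transitivity (\int[mu]_(x in K) \int[mfrestr mK' Koo']_y f (x, y))%E.
  apply: eq_integral => x /set_mem Kx; rewrite restrE; last by move=> y ?; apply: fK; tauto.
  by apply: eq_integral => y /set_mem Ky; rewrite fE.
rewrite E; apply: eq_integral => y /set_mem Ky; rewrite restrE.
  by apply: eq_integral => x /set_mem Kx; rewrite fE.
by move=> x ?; apply: fK; tauto.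
Qed.

Let pushforwardE (t t' : G -> G) (f : borel G -> \bar R) :
  continuous t -> cancel t t' -> cancel t' t ->
  (forall A : set (borel G), measurable A -> mu [set t' x | x in A] = mu A) ->
  measurable_fun setT f -> (forall x, (0 <= f x)%E) ->
  (\int[mu]_x f (t x) = \int[mu]_x f x)%E.
Proof.
move=> ct tK t'K inv mf f0.
have mt := continuous_borel ct.
have := @ge0_integral_pushforward _ _ (borel G) (borel G) R t mt mu setT f
  measurableT mf (fun y _ => f0 y).
rewrite preimage_setT => <-; apply: eq_measure_integral => A mA _.
rewrite /pushforward -[RHS]inv//; congr (mu _).
apply/seteqP; split => [x /= Ax|_ [y Ay <-] /=]; last by rewrite t'K.
by exists (t x).
Qed.

Lemma haar_integral_mull (h : G) (f : borel G -> \bar R) :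
  measurable_fun setT f -> (forall x, (0 <= f x)%E) ->
  (\int[mu]_x f (h * x)%g = \int[mu]_x f x)%E.
Proof.
apply: (pushforwardE (t' := fun x => (h^-1 * x)%g)).
- exact: continuous_mull.
- by move=> x; rewrite mulgA mulVg mul1g.
- by move=> x; rewrite mulgA mulgV mul1g.
- exact: haar_left mu_haar.1 _.
Qed.

Lemma haar_integral_mulr (h : G) (f : borel G -> \bar R) :
  measurable_fun setT f -> (forall x, (0 <= f x)%E) ->
  (\int[mu]_x f (x * h)%g = \int[mu]_x f x)%E.
Proof.
apply: (pushforwardE (t' := fun x => (x * h^-1)%g)).
- exact: continuous_mulr.
- by move=> x; rewrite -mulgA mulgV mulg1.
- by move=> x; rewrite -mulgA mulVg mulg1.
- exact: mu_haar.2.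
Qed.

Lemma haar_integral_compact_approx (h : G -> R) (e : R) : continuous h ->
  (forall x, 0 <= h x) -> (\int[mu]_x (h x)%:E < +oo)%E -> 0 < e ->
  exists2 K : set G, compact K &
    (\int[mu]_x (h x)%:E <= \int[mu]_(x in K) (h x)%:E + e%:E)%E.
Proof.
move=> ch h0 hoo e0.
have mh : measurable_fun [set: borel G] (h : borel G -> R) by exact: continuous_borel_fun.
pose U n : set G := [set x | n.+1%:R^-1 < h x].
have oU n : open (U n).
  by apply: (@open_comp _ _ h [set y | _ < y]); [move=> ? _; exact: ch|exact: open_gt].
have mU n := measurable_open (oU n).
have Uoo n : (mu (U n) < +oo)%E.
  rewrite ltNge leye_eq; apply/negP => /eqP Uy; move: hoo; apply/negP.
  rewrite -leNgt; apply: le_trans (ge0_subset_integral mu (mU n) measurableT _ _ _) => //.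
  - apply: le_trans (ge0_le_integral_nonmeas (f := cst n.+1%:R^-1%:E) mu _ _).
    + by rewrite integral_cst// Uy mulry gtr0_sg ?mul1e// invr_gt0.
    + by move=> x _; rewrite lee_fin invr_ge0.
    + by move=> x Ux; rewrite lee_fin ltW.
  - exact/measurable_EFinP.
  - by move=> x _; rewrite lee_fin.
have mC (K : set G) : compact K -> measurable (K : set (borel G)).
  by move=> cK; apply: measurable_closed; exact: compact_closed.
have /choice[K HK] : forall n, exists K : set G, [/\ compact K, K `<=` U n &
    (mu (U n `\` K) <= (n.+1%:R^-1)%:E)%E].
  move=> n; have n0 : 0 < (n.+1%:R : R)^-1 by rewrite invr_gt0.
  have Ufin : mu (U n) \is a fin_num by rewrite ge0_fin_numE ?measure_ge0.
  have Hi := haar_inner mu_haar.1 (oU n).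
  have Hs := Ufin; rewrite Hi in Hs.
  have [_ [K [cK KU] <-] Hlt] := ub_ereal_sup_adherent n0 Hs.
  have mK := mC _ cK; exists K; split => //.
  have -> : mu (U n `\` K) = (mu (U n) - mu K)%E.
    rewrite measureD; [by rewrite setIidr|exact: mU|exact: mK|exact: Uoo].
  rewrite -Hi in Hlt.
  have Kfin : mu K \is a fin_num.
    by rewrite ge0_fin_numE ?measure_ge0//; exact: (haar_compact_fin mu_haar.1 cK).
  by rewrite leeBlDr// addeC -leeBlDr// ltW.
pose L n : set G := \big[setU/set0]_(i < n) K i.
have cL n : compact (L n).
  rewrite /L; elim/big_ind: _ => //; first exact: compact0.
    by move=> A B cA cB; exact: compactU.
  by move=> i _; have [] := HK i.
have mL n : measurable (L n : set (borel G)) := mC _ (cL n).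
have LE n x : L n x <-> exists2 i, (i < n)%N & K i x.
  rewrite /L -bigcup_mkord; split => [[i /= ? ?]|[i ? ?]]; by exists i.
pose N : set (borel G) := \bigcup_n (U n `\` \bigcup_i K i).
have mKi i : measurable (K i : set (borel G)) by apply: mC; have [] := HK i.
have mUK n : measurable (U n `\` \bigcup_i K i : set (borel G)).
  by apply: measurableD => //; exact: bigcup_measurable.
have N0 : mu.-negligible N.
  apply: negligible_bigcup => n; apply/negligibleP; first exact: mUK.
  apply/eqP; rewrite eq_le measure_ge0 andbT.
  apply/lee_addgt0Pr => d d0; rewrite add0e.
  pose m := maxn n (Num.trunc d^-1).
  have [cm KU Hm] := HK m.
  apply: le_trans (le_measure mu _ _ _) (le_trans Hm _).
  - by rewrite inE.
  - by rewrite inE; exact: measurableD.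
  - move=> x [Ux nK]; split; last by move=> Kx; apply: nK; exists m.
    apply: le_lt_trans Ux; rewrite lef_pV2 ?posrE// ler_nat ltnS; exact: leq_maxl.
  - rewrite lee_fin -[leRHS]invrK lef_pV2 ?posrE ?invr_gt0//.
    by apply: le_trans (ltW (truncnS_gt _)) _; rewrite ler_nat ltnS leq_maxr.
have ih : mu.-integrable setT (EFin \o h : borel G -> _).
  apply/integrableP; split; first exact/measurable_EFinP.
  by under eq_integral do rewrite /= ger0_norm//.
pose f_ n : borel G -> \bar R := (EFin \o h) \_ (L n).
have [||||_ _ Hc] := @dominated_convergence _ (borel G) R mu setT measurableT
    f_ (EFin \o h) (EFin \o h) _ _ _ ih.
- move=> n; apply/(measurable_restrictT _ (mL n)); apply: measurable_funTS.
  exact/measurable_EFinP.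
- exact/measurable_EFinP.
- apply: negligibleS N0 => x /= /not_implyP[_ Hx]; apply: contrapT => Nx; apply: Hx.
  have [hx|hx] := eqVneq (h x) 0.
    rewrite (_ : f_ ^~ x = cst 0%E); first by rewrite hx; exact: cvg_cst.
    by apply/funext => n; rewrite /f_ /patch /= hx; case: ifP.
  pose n := Num.trunc (h x)^-1.
  have hx0 : 0 < h x by rewrite lt_def hx h0.
  have Unx : U n x.
    by rewrite /U /= -[ltRHS]invrK ltf_pV2 ?posrE ?invr_gt0//; exact: truncnS_gt.
  have [i _ Kix] : (\bigcup_i K i) x.
    by apply: contrapT => Kx; apply: Nx; exists n.
  apply: cvg_near_cst; exists i.+1 => // m /= im.
  by rewrite /f_ patchT// inE; apply/LE; exists i.
- apply: aeW => x n _; rewrite /f_ /patch; case: ifPn => _ //=.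
    by rewrite ger0_norm.
  by rewrite normr0 lee_fin.
set I := (\int[mu]_x (h x)%:E)%E in hoo *.
have Ifin : I \is a fin_num.
  by rewrite ge0_fin_numE//; apply: integral_ge0 => x _; rewrite lee_fin.
apply: contrapT => Hno.
have Hn n : (\int[mu]_x f_ n x <= I - e%:E)%E.
  rewrite leeBrDr// leNgt; apply/negP => Hlt; apply: Hno; exists (L n) => //.
  by apply: ltW; rewrite integral_mkcond.
have := cvg_lim (@ereal_hausdorff R) Hc => E.
have : (I <= I - e%:E)%E.
  by rewrite -[leLHS]E; apply: lime_le; [apply: cvgP Hc|apply: nearW].
by rewrite leeBrDr// -[X in (_ <= X)%E]adde0 leeD2lE// lee_fin leNgt e0.
Qed.

(* Tonelli's theorem on compact rectangles gives [(\int_K h)^2 <= I * I'],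
   where [I] and [I'] are the integrals of [h] and of its inversion. *)
Let haar_integral_inv_le (h : G -> R) : continuous h -> (forall x, 0 <= h x) ->
  (\int[mu]_x (h x)%:E < +oo)%E -> (\int[mu]_x (h x^-1%g)%:E < +oo)%E ->
  (\int[mu]_x (h x)%:E <= \int[mu]_x (h x^-1%g)%:E)%E.
Proof.
move=> ch h0 Ioo I'oo.
have mC (K : set G) : compact K -> measurable (K : set (borel G)).
  by move=> cK; apply: measurable_closed; exact: compact_closed.
have mh : measurable_fun [set: borel G] (EFin \o h : borel G -> _).
  by apply/measurable_EFinP; exact: continuous_borel_fun.
have mhi : measurable_fun [set: borel G] (fun x : borel G => (h x^-1%g)%:E).
  apply/measurable_EFinP; apply: (@continuous_borel_fun R G (fun x => h x^-1%g)) => x.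
  apply: (@continuous_comp _ _ _ (fun x : G => x^-1%g) h);
    [exact: invg_continuous|exact: ch].
have eh0 x : (0 <= (h x)%:E)%E by rewrite lee_fin.
set I := (\int[mu]_x (h x)%:E)%E in Ioo *.
set I' := (\int[mu]_x (h x^-1%g)%:E)%E in I'oo *.
have cmul : continuous (fun z : G * G => h (z.2 * z.1)%g).
  move=> z; apply: (@continuous_comp _ _ _ (fun z : G * G => (z.2 * z.1)%g) h); last exact: ch.
  apply: (@continuous_comp _ _ _ (fun z : G * G => (z.2, z.1)) (fun z => (z.1 * z.2)%g)).
    by apply: cvg_pair; [exact: cvg_snd|exact: cvg_fst].
  exact: mulg_continuous.
have main (K : set G) : compact K ->
    ((\int[mu]_(x in K) (h x)%:E) * (\int[mu]_(x in K) (h x)%:E) <= I * I')%E.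
  move=> cK; set J := (\int[mu]_(x in K) (h x)%:E)%E.
  have cim2 (A B : set G) (f : G * G -> G) : compact A -> compact B -> continuous f ->
      compact [set f z | z in A `*` B].
    move=> cA cB cf; apply: continuous_compact; last exact: compact_setX.
    exact: continuous_subspaceT.
  pose K1 : set G := [set (z.1^-1 * z.2)%g | z in K `*` K].
  have cK1 : compact K1.
    apply: (cim2 K K (fun z => (z.1^-1 * z.2)%g)) => // z.
    apply: (@continuous_comp _ _ _ (fun z : G * G => (z.1^-1%g, z.2)) (fun z => (z.1 * z.2)%g)).
      apply: cvg_pair; last exact: cvg_snd.
      apply: (@continuous_comp _ _ _ (fun z : G * G => z.1) (fun x : G => x^-1%g)).
        exact: cvg_fst.
      exact: invg_continuous.
    exact: mulg_continuous.
  pose K2 : set G := [set (z.1 * z.2)%g | z in K `*` K1].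
  have cK2 : compact K2.
    by apply: (cim2 K K1 (fun z => (z.1 * z.2)%g)) => //; exact: mulg_continuous.
  have J0 : (0 <= J)%E by exact: integral_ge0.
  have mK := mC _ cK; have mK1 := mC _ cK1; have mK2 := mC _ cK2.
  have step1 : (J * J <= \int[mu]_(y in K) \int[mu]_(x in K1) (h y * h (y * x)%g)%:E)%E.
    have -> : (J * J = \int[mu]_(x in K) (J * (h x)%:E))%E.
      by rewrite ge0_integralZl//; exact: measurable_funTS.
    apply: ge0_le_integral_nonmeas => y Ky; first by rewrite mule_ge0.
    under eq_integral do rewrite EFinM.
    rewrite ge0_integralZl//; last first.
      apply: measurable_funTS; apply: (measurableT_comp mh).
      by apply: continuous_borel; exact: continuous_mull.
    rewrite muleC; apply: lee_wpmul2l => //.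
    have mf : measurable_fun [set: borel G] ((fun x : borel G => (h x)%:E) \_ K).
      by apply/(measurable_restrictT _ mK); exact: measurable_funTS.
    rewrite [leLHS]integral_mkcond -(haar_integral_mull y mf); last first.
      by move=> x; rewrite /patch; case: ifP.
    rewrite [leRHS]integral_mkcond; apply: ge0_le_integral_nonmeas => x _.
      by rewrite /patch; case: ifP.
    rewrite /patch; case: ifPn => [/set_mem Kyx|_]; last by case: ifP.
    by rewrite ifT// inE; exists (y, (y * x)%g) => //=; rewrite mulgA mulVg mul1g.
  apply: le_trans step1 _.
  rewrite (@haar_tonelli_compact K K1 (fun y x => h y * h (y * x)%g))//; last 2 first.
  - move=> z; apply: (@continuousM _ _ (fun z : G * G => h z.1) (fun z => h (z.1 * z.2)%g)).
      by apply: (@continuous_comp _ _ _ (fun z : G * G => z.1) h); [exact: cvg_fst|exact: ch].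
    by apply: (@continuous_comp _ _ _ (fun z : G * G => (z.1 * z.2)%g) h);
        [exact: mulg_continuous|exact: ch].
  - by move=> x y; rewrite mulr_ge0.
  have step2 : (\int[mu]_(x in K1) \int[mu]_(y in K) (h y * h (y * x)%g)%:E <=
      \int[mu]_(x in K1) \int[mu]_(y in K2) (h y * h (y * x^-1)%g)%:E)%E.
    apply: ge0_le_integral_nonmeas => x Kx.
      by apply: integral_ge0 => y _; rewrite lee_fin mulr_ge0.
    rewrite [leLHS]integral_mkcond.
    have mf : measurable_fun [set: borel G] ((fun y : borel G => (h y * h (y * x)%g)%:E) \_ K).
      apply/(measurable_restrictT _ mK); apply: measurable_funTS.
      apply/measurable_EFinP; apply: measurable_funM; first exact: continuous_borel_fun.
      apply: (@continuous_borel_fun R G (fun y => h (y * x)%g)) => y.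
      apply: (@continuous_comp _ _ _ (fun y : G => (y * x)%g) h);
        [exact: continuous_mulr|exact: ch].
    rewrite -(haar_integral_mulr x^-1%g mf); last first.
      by move=> y; rewrite /patch; case: ifP => // _; rewrite lee_fin mulr_ge0.
    rewrite [leRHS]integral_mkcond; apply: ge0_le_integral_nonmeas => y _.
      by rewrite /patch; case: ifP => // _; rewrite lee_fin mulr_ge0.
    rewrite /patch -mulgA mulVg mulg1; case: ifPn => [/set_mem Kyx|_]; last first.
      by case: ifP => // _; rewrite lee_fin mulr_ge0.
    rewrite ifT; first by rewrite mulrC.
    by rewrite inE; exists ((y * x^-1)%g, x) => //=; rewrite -mulgA mulVg mulg1.
  apply: le_trans step2 _.
  rewrite (@haar_tonelli_compact K1 K2 (fun x y => h y * h (y * x^-1)%g))//; last 2 first.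
  - move=> z; apply: (@continuousM _ _ (fun z : G * G => h z.2) (fun z => h (z.2 * z.1^-1)%g)).
      by apply: (@continuous_comp _ _ _ (fun z : G * G => z.2) h); [exact: cvg_snd|exact: ch].
    apply: (@continuous_comp _ _ _ (fun z : G * G => (z.1^-1%g, z.2)) (fun z => h (z.2 * z.1)%g));
      last exact: cmul.
    apply: cvg_pair; last exact: cvg_snd.
    apply: (@continuous_comp _ _ _ (fun z : G * G => z.1) (fun x : G => x^-1%g));
      first exact: cvg_fst.
    exact: invg_continuous.
  - by move=> x y; rewrite mulr_ge0.
  apply: (@le_trans _ _ (\int[mu]_(y in K2) ((h y)%:E * I'))%E).
    apply: ge0_le_integral_nonmeas => y Ky.
      by apply: integral_ge0 => x _; rewrite lee_fin mulr_ge0.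
    under eq_integral do rewrite EFinM.
    have mhy : measurable_fun [set: borel G] (fun x : borel G => (h (y * x^-1)%g)%:E).
      have := measurableT_comp mhi (continuous_borel (@continuous_mulr G y^-1%g)).
      by apply: eq_measurable_fun => x _ /=; rewrite invgM invgK.
    rewrite ge0_integralZl//; last exact: measurable_funTS.
    apply: lee_wpmul2l => //.
    apply: le_trans (ge0_subset_integral mu mK1 measurableT mhy _ _) _ => //.
    rewrite /I' -(haar_integral_mulr y^-1%g mhi)//.
    by under [leRHS]eq_integral do rewrite invgM invgK.
  under eq_integral do rewrite muleC.
  rewrite ge0_integralZl//; last 2 first.
  - exact: measurable_funTS.
  - by apply: integral_ge0 => x _.
  rewrite muleC; apply: lee_wpmul2r; first by apply: integral_ge0 => x _.
  exact: ge0_subset_integral.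
have Ifin : I \is a fin_num.
  by rewrite ge0_fin_numE//; apply: integral_ge0 => x _; rewrite lee_fin.
have I'fin : I' \is a fin_num.
  by rewrite ge0_fin_numE//; apply: integral_ge0 => x _; rewrite lee_fin.
rewrite leNgt; apply/negP => lt.
have i'0 : 0 <= fine I' by apply: fine_ge0; apply: integral_ge0 => x _; rewrite lee_fin.
have lt' : fine I' < fine I by rewrite -lte_fin !fineK.
have e0 : 0 < (fine I - fine I') / 2 by rewrite divr_gt0// subr_gt0.
have [K cK] := haar_integral_compact_approx ch h0 Ioo e0.
have := main K cK; set J := (\int[mu]_(x in K) (h x)%:E)%E.
have J0 : (0 <= J)%E by apply: integral_ge0 => x _.
have Jfin : J \is a fin_num.
  rewrite ge0_fin_numE//; apply: le_lt_trans Ioo.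
  by apply: ge0_subset_integral => //; exact: mC.
rewrite -/I -(fineK Ifin) -(fineK I'fin) -(fineK Jfin) -!EFinM -EFinD !lee_fin.
move: (fine J) (fine I) (fine I') (fine_ge0 J0) lt' i'0 => {J0 Jfin}j i i' j0 ii' i'0 H1 H2.
have H3 : (i + i') / 2 <= j by move: H2 => /=; lra.
have H4 : (i + i') / 2 * ((i + i') / 2) <= j * j by apply: ler_pM => //; lra.
have : 0 < (i - i') ^+ 2 by rewrite exprn_gt0// subr_gt0.
nra.
Qed.

Lemma haar_integral_inv (h : G -> R) : continuous h -> (forall x, 0 <= h x) ->
  (\int[mu]_x (h x)%:E < +oo)%E -> (\int[mu]_x (h x^-1%g)%:E < +oo)%E ->
  (\int[mu]_x (h x^-1%g)%:E = \int[mu]_x (h x)%:E)%E.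
Proof.
move=> ch h0 Ioo I'oo; apply/eqP; rewrite eq_le haar_integral_inv_le// andbT.
have chi : continuous (fun x : G => h x^-1%g).
  by move=> x; apply: (@continuous_comp _ _ _ (fun x : G => x^-1%g) h);
    [exact: invg_continuous|exact: ch].
have := haar_integral_inv_le chi (fun x => h0 _) I'oo.
by under eq_integral do rewrite invgK; apply.
Qed.

End HaarIntegral.

(** * Square-integrable kernels on the group *)

Section SquareIntegrable.
Context (R : realType) (G : topGroupType)
  (mu : {measure set (borel G) -> \bar R}).

Definition int_sq (f : G -> R) : \bar R := (\int[mu]_g (f g ^+ 2)%:E)%E.

Lemma int_sq_ge0 f : (0 <= int_sq f)%E.
Proof. by apply: integral_ge0 => g _; rewrite lee_fin sqr_ge0. Qed.

Lemma integrable_mul (f w : G -> R) : continuous f -> continuous w ->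
  (int_sq f < +oo)%E -> (int_sq w < +oo)%E ->
  mu.-integrable [set: borel G] (EFin \o (fun g => f g * w g)).
Proof.
move=> cf cw foo woo.
have mf : measurable_fun [set: borel G] (f : borel G -> R) := continuous_borel_fun cf.
have mw : measurable_fun [set: borel G] (w : borel G -> R) := continuous_borel_fun cw.
have isq (h : G -> R) : measurable_fun [set: borel G] (h : borel G -> R) ->
    (int_sq h < +oo)%E -> mu.-integrable [set: borel G] (fun g => (h g ^+ 2)%:E).
  move=> mh hoo; apply/integrableP; split.
    by apply/measurable_EFinP; exact: measurable_funX.
  by under eq_integral do rewrite /= ger0_norm ?sqr_ge0//.
apply: le_integrable (integrableD _ (isq f mf foo) (isq w mw woo)) => //.
  by apply/measurable_EFinP; exact: measurable_funM.
move=> g _ /=; rewrite lee_fin [leRHS]ger0_norm ?addr_ge0 ?sqr_ge0//.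
rewrite normrM -[f g ^+ 2]real_normK ?num_real// -[w g ^+ 2]real_normK ?num_real//.
have := sqr_ge0 (`|f g| - `|w g|); have := sqr_ge0 (`|f g| + `|w g|); nra.
Qed.

Variable I : finType.
Implicit Types f w u : G * I -> R^o.

Definition fiber f i : G -> R := fun g => f (g, i).

Definition cL2 : set (G * I -> R^o) := [set f | forall i,
  continuous (fiber f i) /\ (int_sq (fiber f i) < +oo)%E].

Definition ipL2 f w : R := \sum_i Rintegral mu setT (fun g => f (g, i) * w (g, i)).

Lemma cL2_integrable f w i : cL2 f -> cL2 w ->
  mu.-integrable [set: borel G] (EFin \o (fun g => f (g, i) * w (g, i))).
Proof.
by move=> /(_ i)[cf foo] /(_ i)[cw woo]; exact: (integrable_mul cf cw foo woo).
Qed.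

Lemma ipL2E f : cL2 f -> (ipL2 f f)%:E = (\sum_i int_sq (fiber f i))%E.
Proof.
move=> Lf; rewrite /ipL2 -sumEFin; apply: eq_bigr => i _.
rewrite /Rintegral fineK; last exact: integrable_fin_num (cL2_integrable i Lf Lf).
by apply: eq_integral => g _; rewrite /fiber expr2.
Qed.

Lemma cL2_psd : psd_form cL2 ipL2.
Proof.
have Llin (a : R) f w : cL2 f -> cL2 w -> cL2 (a *: f + w).
  move=> Lf Lw i; have [cf foo] := Lf i; have [cw woo] := Lw i.
  have E g : fiber (a *: f + w) i g = a * fiber f i g + fiber w i g by [].
  have cE : continuous (fiber (a *: f + w) i).
    move=> g; rewrite (_ : fiber _ _ = (fun g => a * fiber f i g + fiber w i g))//.
    by apply: cvgD; [apply: cvgM; [exact: cvg_cst|exact: cf]|exact: cw].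
  split => //; have If := cL2_integrable i Lf Lf; have Iw := cL2_integrable i Lw Lw.
  have H := integrableD measurableT (integrableZl measurableT (2 * a ^+ 2) If)
    (integrableZl measurableT 2 Iw).
  apply: le_lt_trans (integrable_lty measurableT H).
  apply: ge0_le_integral_nonmeas => g _; rewrite lee_fin ?sqr_ge0//=.
  rewrite E /fiber; have := sqr_ge0 (a * f (g, i) - w (g, i)); nra.
split => //.
- move=> i; have c0 : continuous (fiber (0 : G * I -> R^o) i).
    by move=> g; exact: cvg_cst.
  split => //; rewrite /int_sq integral0_eq ?ltry// => g _.
  by rewrite /fiber expr0n.
- by move=> f w _ _; apply: eq_bigr => i _; apply: eq_Rintegral => g _; rewrite mulrC.
- move=> a f w v Lf Lw Lv; rewrite /ipL2 mulr_sumr -big_split; apply: eq_bigr => i _.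
  have If := cL2_integrable i Lf Lv; have Iw := cL2_integrable i Lw Lv.
  rewrite /= -RintegralZl// -RintegralD//; last exact: (integrableZl measurableT a If).
  apply: eq_Rintegral => g _.
  have -> : (a *: f + w) (g, i) = a * f (g, i) + w (g, i) by [].
  by rewrite mulrDl mulrA.
- move=> f Lf; apply: sumr_ge0 => i _; apply: Rintegral_ge0 => g _.
  by rewrite -expr2 sqr_ge0.
Qed.

Lemma cL2_fatou (u : nat -> G * I -> R^o) f (c : R) (n0 : nat) :
  (forall n, cL2 (u n)) -> (forall i, continuous (fiber f i)) ->
  (forall x, (fun n => u n x) @ \oo --> f x) ->
  (forall n, (n0 <= n)%N -> ipL2 (u n) (u n) <= c) ->
  cL2 f /\ ipL2 f f <= #|I|%:R * c.
Proof.
move=> Lu cf uf uc.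
have le i : (int_sq (fiber f i) <= c%:E)%E.
  have mu_ n : measurable_fun [set: borel G] (fun g : borel G => (u n (g, i) ^+ 2)%:E).
    apply/measurable_EFinP; apply: measurable_funX.
    by have [cu _] := Lu n i; exact: (continuous_borel_fun cu).
  have u0 n (g : borel G) : (0 <= (u n (g, i) ^+ 2)%:E)%E.
    by rewrite lee_fin sqr_ge0.
  have := fatou mu measurableT mu_ (fun n g _ => u0 n g).
  have -> : (\int[mu]_g limn_einf ((fun n => (u n (g, i) ^+ 2)%:E)))%E =
      int_sq (fiber f i).
    apply: eq_integral => g _.
    have cv : (u n (g, i) ^+ 2)%:E @[n --> \oo] --> (f (g, i) ^+ 2)%:E.
      by apply: cvg_EFin; [exact: nearW|apply: cvgM; exact: uf].
    by rewrite is_cvg_limn_einfE; [exact: cvg_lim cv|exact: cvgP cv].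
  move=> /le_trans; apply; rewrite limn_einf_lim.
  apply: lime_le; first exact: is_cvg_einfs.
  exists n0 => // n /= nn0; apply: le_trans (_ : _ <= int_sq (fiber (u n) i))%E _.
    by apply: ereal_inf_lbound; exists n => /=.
  apply: le_trans (_ : _ <= \sum_j int_sq (fiber (u n) j))%E _.
    by rewrite (bigD1 i)//= leeDl// sume_ge0// => j _; exact: int_sq_ge0.
  by rewrite -ipL2E// lee_fin uc.
have Lf : cL2 f by move=> i; split => //; exact: le_lt_trans (le i) (ltry _).
split => //; rewrite -lee_fin ipL2E//.
apply: le_trans (_ : _ <= \sum_(i : I) c%:E)%E _; first exact: lee_sum.
by rewrite sumEFin sumr_const mulr_natl.
Qed.

Hypothesis hausG : hausdorff_space G.
Hypothesis mu_haar : haar_measure mu.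

Definition ltrans (h : G) : G * I -> G * I := fun x => ((h * x.1)%g, x.2).

Lemma ltransK h : cancel (ltrans h) (ltrans h^-1%g).
Proof. by case=> g i; rewrite /ltrans/= mulgA mulVg mul1g. Qed.

Lemma ltransVK h : cancel (ltrans h^-1%g) (ltrans h).
Proof. by case=> g i; rewrite /ltrans/= mulgA mulgV mul1g. Qed.

Lemma cL2_ltrans h f w : cL2 f -> cL2 w ->
  cL2 (f \o ltrans h : _ -> R^o) /\
  ipL2 (f \o ltrans h : _ -> R^o) (w \o ltrans h) = ipL2 f w.
Proof.
have sqE v i : cL2 v -> int_sq (fiber (v \o ltrans h : _ -> R^o) i) = int_sq (fiber v i).
  move=> /(_ i)[cf _].
  have mf : measurable_fun [set: borel G] (fun g : borel G => (fiber v i g ^+ 2)%:E).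
    by apply/measurable_EFinP/measurable_funX; exact: (continuous_borel_fun cf).
  by rewrite /int_sq -(haar_integral_mull mu_haar h mf)// => g; rewrite lee_fin sqr_ge0.
have Lt v : cL2 v -> cL2 (v \o ltrans h : _ -> R^o).
  move=> Lv i; rewrite sqE//; have [cf foo] := Lv i; split => // g.
  by apply: (@continuous_comp _ _ _ (fun g => (h * g)%g) (fiber v i));
    [exact: continuous_mull|exact: cf].
have qE v : cL2 v -> ipL2 (v \o ltrans h : _ -> R^o) (v \o ltrans h) = ipL2 v v.
  move=> Lv; apply: EFin_inj; rewrite !ipL2E//; last exact: Lt.
  by apply: eq_bigr => i _; exact: sqE.
move=> Lf Lw; split; first exact: Lt.
have P := cL2_psd; have Ls := psd_domD P Lf (psd_domZ P 1 Lw).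
have := qE _ Ls.
have -> : (f + 1 *: w) \o ltrans h =
    (f \o ltrans h : _ -> R^o) + 1 *: (w \o ltrans h : _ -> R^o) by [].
rewrite !(psd_expand P)//; [|exact: Lt|exact: Lt].
by rewrite !qE//; lra.
Qed.

Lemma Rintegral_inv (f : G -> R) : continuous f ->
  mu.-integrable [set: borel G] (EFin \o f : borel G -> _) ->
  mu.-integrable [set: borel G] (EFin \o (fun g => f g^-1%g) : borel G -> _) ->
  Rintegral mu setT (fun g => f g^-1%g) = Rintegral mu setT f.
Proof.
move=> cf If Ifi.
have ge0 (h : G -> R) : continuous h -> (forall x, 0 <= h x) ->
  mu.-integrable [set: borel G] (EFin \o h : borel G -> _) ->
  mu.-integrable [set: borel G] (EFin \o (fun g => h g^-1%g) : borel G -> _) ->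
  Rintegral mu setT (fun g => h g^-1%g) = Rintegral mu setT h.
  move=> ch h0 Ih Ihi; congr fine; apply: haar_integral_inv => //.
    exact: integrable_lty Ih.
  exact: integrable_lty Ihi.
have cn : continuous (fun x => `|f x|).
  by move=> x; apply: cvg_norm; exact: cf.
have In := integrable_norm If; have Ini := integrable_norm Ifi.
have E1 := ge0 _ cn (fun x => normr_ge0 _) In Ini.
have E2 : Rintegral mu setT (fun g => `|f g^-1%g| + f g^-1%g) =
    Rintegral mu setT (fun g => `|f g| + f g).
  apply: (ge0 (fun g => `|f g| + f g)).
  - by move=> x; apply: cvgD; [exact: cn|exact: cf].
  - by move=> x; have := ler_norm (- f x); rewrite normrN; lra.
  - exact: (integrableD measurableT In If).
  - exact: (integrableD measurableT Ini Ifi).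
move: E2; rewrite !RintegralD// E1; exact: addrI.
Qed.

Lemma cL2_weak f (C e : R) : cL2 f -> 0 < e -> exists2 d, 0 < d &
  forall u, cL2 u -> ipL2 u u <= C -> (forall x, `|u x| <= d) ->
  `|ipL2 f u| <= e.
Proof.
move=> Lf e0.
pose f2 (m : nat) : G * I -> R^o := fun x => f x / (m.+1%:R * f x ^+ 2 + 1).
pose f1 (m : nat) : G * I -> R^o := fun x => m.+1%:R * f x ^+ 3 / (m.+1%:R * f x ^+ 2 + 1).
have den0 m x : 0 < m.+1%:R * f x ^+ 2 + 1.
  by apply: ltr_wpDl => //; rewrite mulr_ge0// sqr_ge0.
have f12 m : f = f1 m + f2 m.
  apply/funext => x; change (f x = f1 m x + f2 m x); rewrite /f1 /f2.
  rewrite -mulrDl -[LHS](mulfK (lt0r_neq0 (den0 m x))); congr (_ / _); ring.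
have le2 m x : f2 m x ^+ 2 <= f x ^+ 2.
  rewrite /f2 expr_div_n ler_pdivrMr ?exprn_gt0// ler_peMr ?sqr_ge0//.
  by rewrite exprn_ege1// lerDr mulr_ge0// sqr_ge0.
have le2' m x : f2 m x ^+ 2 <= m.+1%:R^-1.
  rewrite /f2 expr_div_n ler_pdivrMr ?exprn_gt0// ler_pdivlMl//.
  have m1 : 0 <= m.+1%:R * f x ^+ 2 by rewrite mulr_ge0// sqr_ge0.
  by move: m1; set a := _ * _; nra.
have le1 m x : `|f1 m x| <= m.+2%:R * (f x * f x).
  rewrite /f1 normf_div normrM normrX (gtr0_norm (den0 m x)) ler_pdivrMr//.
  rewrite -expr2 -real_normK ?num_real// ger0_norm// -[m.+2%:R]natr1.
  move: (normr_ge0 (f x)) (ler0n R m.+1); set y := `|f x|; set a := m.+1%:R => y0 a0.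
  have H : a * y <= (a + 1) * (a * y ^+ 2 + 1).
    have := mulr_ge0 a0 (sqr_ge0 (y - 1)); have := mulr_ge0 a0 (sqr_ge0 y).
    have := mulr_ge0 (mulr_ge0 a0 a0) (sqr_ge0 y); nra.
  have := ler_wpM2r (sqr_ge0 y) H; nra.
have L2 m : cL2 (f2 m).
  move=> i; have [cf foo] := Lf i; split.
    move=> g; apply: cvgM; first exact: cf.
    apply: cvgV; first by rewrite gt_eqF.
    apply: cvgD; last exact: cvg_cst.
    by apply: cvgM; [exact: cvg_cst|apply: cvgM; exact: cf].
  apply: le_lt_trans foo; apply: ge0_le_integral_nonmeas => g _; rewrite lee_fin ?sqr_ge0//.
  exact: le2.
have P := cL2_psd.
have L1 m : cL2 (f1 m).
  have -> : f1 m = f - f2 m by rewrite [in RHS](f12 m) addrK.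
  exact: (psd_domB P).
have to0 : (fun m => ipL2 (f2 m) (f2 m)) @ \oo --> 0.
  suff : (fun m => ipL2 (f2 m) (f2 m)) @ \oo --> \sum_(i : I) (0 : R) by rewrite big1.
  apply: cvg_big => [|i _]; first exact: add_continuous.
  have [cf foo] := Lf i; have If := cL2_integrable i Lf Lf.
  have [|||| _ _ Hc] := @dominated_convergence _ (borel G) R mu setT measurableT
    (fun m g => (f2 m (g, i) * f2 m (g, i))%:E) (cst 0%E)
    (EFin \o (fun g => f (g, i) * f (g, i))) _ _ _ If.
  - by move=> m; exact: measurable_int (cL2_integrable i (L2 m) (L2 m)).
  - exact: measurable_cst.
  - apply: aeW => g _; apply: cvg_EFin; first exact: nearW.
    apply: (@squeeze_cvgr _ _ _ _ (cst 0) (@harmonic R)); last exact: cvg_harmonic.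
      by apply: nearW => m; rewrite /= -expr2 sqr_ge0 le2'.
    exact: cvg_cst.
  - by apply: aeW => g m _; rewrite /= lee_fin -!expr2 ger0_norm ?sqr_ge0 ?le2.
  by move: Hc; rewrite integral0 => /fine_cvgP[].
pose C' := `|C| + 1.
have C0 : 0 < C' by rewrite ltr_wpDl.
have e20 : 0 < (e / 2) ^+ 2 / C' by rewrite divr_gt0// exprn_gt0// divr_gt0.
have [m _ /(_ m (leqnn m)) /= Hm] := cvgr0_norm_le _ to0 _ e20.
have N0 := psd_ge0 P Lf.
pose d := e / (2 * m.+2%:R * (ipL2 f f + 1)).
have d0 : 0 < d by rewrite divr_gt0// !mulr_gt0// ltr_wpDl.
exists d => // u Lu uC ud.
have -> : ipL2 f u = ipL2 (f1 m) u + ipL2 (f2 m) u by rewrite [in LHS](f12 m) (psdDl P).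
rewrite (splitr e); apply: le_trans (ler_normD _ _) _; apply: lerD; last first.
  have e2 : 0 <= e / 2 by rewrite ltW// divr_gt0.
  rewrite -ler_sqr ?nnegrE// real_normK ?num_real//.
  apply: le_trans (psd_CS P (L2 m) Lu) _.
  move: Hm; rewrite ger0_norm ?(psd_ge0 P (L2 m))// => Hm.
  have uC' : ipL2 u u <= C'.
    by apply: le_trans uC _; rewrite /C'; have := ler_norm C; lra.
  apply: le_trans (ler_pM (psd_ge0 P (L2 m)) (psd_ge0 P Lu) Hm uC') _.
  by rewrite divfK// gt_eqF.
apply: le_trans (_ : _ <= \sum_i m.+2%:R * d * Rintegral mu setT (fun g => f (g, i) * f (g, i))) _.
  apply: le_trans (ler_norm_sum _ _ _) _; apply: ler_sum => i _.
  have Iu := cL2_integrable i (L1 m) Lu; have If := cL2_integrable i Lf Lf.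
  apply: le_trans (le_normr_Rintegral measurableT Iu) _.
  rewrite -RintegralZl//; apply: le_Rintegral => //.
  - exact: integrable_norm Iu.
  - exact: (integrableZl measurableT (m.+2%:R * d) If).
  - move=> g _; rewrite normrM mulrAC; apply: ler_pM => //; exact: le1.
rewrite -mulr_sumr -/(ipL2 f f) /d; set N := ipL2 f f in N0 *; set n := m.+2%:R.
have -> : n * (e / (2 * n * (N + 1))) * N = e / 2 * (N / (N + 1)).
  have n0 : n != 0 by rewrite pnatr_eq0.
  have N1 : N + 1 != 0 by rewrite gt_eqF// ltr_wpDl.
  by move: n N n0 N1 {N0} => n N n0 N1; field; rewrite N1 n0.
by rewrite ler_piMr ?divr_ge0 ?ltW// ltr_pdivrMr ?ltr_wpDl// mul1r ltrDl.
Qed.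

End SquareIntegrable.

Section MatrixKernels.
Context (R : realType) (G : topGroupType)
  (mu : {measure set (borel G) -> \bar R}) (I : finType).
Hypothesis hausG : hausdorff_space G.
Hypothesis mu_haar : haar_measure mu.
Implicit Types (Phi : G -> I -> I -> R).

Definition mx_kernel Phi : G * I -> G * I -> R :=
  fun x y => Phi (y.1^-1 * x.1)%g x.2 y.2.

Record l2_kernel Phi : Prop := {
  l2k_continuous : forall i j, continuous (fun g => Phi g i j) ;
  l2k_int_sq : forall i j, (int_sq mu (fun g => Phi g i j) < +oo)%E ;
  l2k_psd : psd_kernel (mx_kernel Phi) }.

Definition bounded_kernel Phi : Prop := exists2 C : R, 0 < C &
  forall s, ipL2 mu (ksum (mx_kernel Phi) s) (ksum (mx_kernel Phi) s) <=
            C * ev s (ksum (mx_kernel Phi) s).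

Lemma mx_kernel_ltrans Phi h x y :
  mx_kernel Phi (ltrans h x) (ltrans h y) = mx_kernel Phi x y.
Proof. by rewrite /mx_kernel /ltrans /= invgM mulgA -[((_ * _) * h)%g]mulgA mulVg mulg1. Qed.

Section Kernel.
Variable Phi : G -> I -> I -> R.
Hypothesis PhiP : l2_kernel Phi.
Local Notation k := (mx_kernel Phi).
Let kP : psd_kernel k := l2k_psd PhiP.
Local Notation b := (rk_form k).
Let bP : psd_form (rkhs k) b := rk_form_psd kP.

Lemma mx_kernelE x y : k x y = Phi (x.1^-1 * y.1)%g y.2 x.2.
Proof. by rewrite (kernelC kP). Qed.

Lemma mx_kernel_ltransl h x : (k x : _ -> R^o) \o ltrans h^-1%g = k (ltrans h x).
Proof.
by apply/funext => y; rewrite /= -(mx_kernel_ltrans Phi h x) ltransVK.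
Qed.

Lemma rkhs_ltrans h f w : rkhs k f -> rkhs k w ->
  rkhs k (f \o ltrans h : _ -> R^o) /\
  b (f \o ltrans h : _ -> R^o) (w \o ltrans h) = b f w.
Proof.
move=> Df Dw; apply: (rkhs_comp _ _ Df Dw); first exact: ltransVK.
by move=> x y; exact: mx_kernel_ltrans.
Qed.

Lemma rkhs_continuous f i : rkhs k f -> continuous (fiber f i).
Proof.
move=> Df g0; apply/cvgrPdist_le => e e0.
pose B := b f f + 1.
have B0 : 0 < B by rewrite ltr_wpDl// (psd_ge0 bP).
pose d := e ^+ 2 / (2 * B).
have d0 : 0 < d by rewrite divr_gt0 ?exprn_gt0// mulr_gt0.
have cPhi : (fun g => Phi (g0^-1 * g)%g i i) @ g0 --> Phi 1%g i i.
  rewrite -[X in _ --> Phi X _ _](mulVg g0).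
  apply: (@continuous_comp _ _ _ (fun g => (g0^-1 * g)%g) (fun g => Phi g i i)).
    exact: continuous_mull.
  exact: (l2k_continuous PhiP).
move/cvgrPdist_le : cPhi => /(_ d d0); apply: filterS => g Hg.
have Dx := rkhs_kernel kP (g, i); have Dx0 := rkhs_kernel kP (g0, i).
have Dd := psd_domB bP Dx0 Dx.
have E : fiber f i g0 - fiber f i g = b f (k (g0, i) - k (g, i)).
  by rewrite (psdBr bP)// !rk_form_kernel.
rewrite -ler_sqr ?nnegrE ?(ltW e0)// real_normK ?num_real// E.
apply: le_trans (psd_CS bP Df Dd) _.
rewrite (psdBl bP)// !(psdBr bP)// !rk_form_kernel//.
rewrite (kernelC kP (g0, i) (g, i)).
have -> : k (g, i) (g, i) = Phi 1%g i i by rewrite /mx_kernel mulVg.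
have -> : k (g0, i) (g0, i) = Phi 1%g i i by rewrite /mx_kernel mulVg.
have -> : k (g, i) (g0, i) = Phi (g0^-1 * g)%g i i by [].
set a := Phi 1%g i i in Hg *; set c := Phi _ i i in Hg *.
have ac : a - c <= d by apply: le_trans Hg; exact: ler_norm.
have b0 : 0 <= b f f by exact: (psd_ge0 bP).
have -> : e ^+ 2 = B * (2 * d) by rewrite /d; field; rewrite gt_eqF.
rewrite (_ : a - c - (c - a) = 2 * (a - c)); last by ring.
have H1 : b f f * (2 * (a - c)) <= b f f * (2 * d) by rewrite ler_wpM2l// ler_pM2l.
have BB : b f f <= B by rewrite /B lerDl.
by apply: le_trans H1 _; rewrite ler_wpM2r// mulr_ge0// ltW.
Qed.

Lemma cL2_kernel x : cL2 mu (k x : _ -> R^o).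
Proof.
have L0 i : cL2 mu (fun y => Phi y.1 y.2 i : R^o).
  by move=> j; split; [exact: (l2k_continuous PhiP)|exact: (l2k_int_sq PhiP)].
have [+ _] := cL2_ltrans mu_haar x.1^-1%g (L0 x.2) (L0 x.2).
by congr (cL2 mu _); apply/funext => y; rewrite mx_kernelE.
Qed.

Let Dom : set (G * I -> R^o) := [set f | rkhs k f /\ cL2 mu f].

Section Regularize.
Variable t : R.
Hypothesis t0 : 0 < t.
Let bt f w : R := t * b f w + ipL2 mu f w.
Let L := @cL2_psd R G mu I.

Let btP : psd_form Dom bt.
Proof.
split.
- move=> a f w [Df Lf] [Dw Lw]; split; first exact: (psd_lin bP).
  exact: (psd_lin L).
- by split; [exact: (psd_dom0 bP)|exact: (psd_dom0 L)].
- by move=> f w [Df Lf] [Dw Lw]; rewrite /bt (psdC bP)// (psdC L).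
- move=> a f w v [Df Lf] [Dw Lw] [Dv Lv].
  by rewrite /bt (psd_linl bP)// (psd_linl L)//; ring.
- move=> f [Df Lf]; have h1 := psd_ge0 bP Df; have h2 := psd_ge0 L Lf.
  by apply: addr_ge0 => //; apply: mulr_ge0 => //; exact: ltW.
Qed.

Let bt_complete : complete_form Dom bt.
Proof.
move=> u Du uC.
have le_b f : Dom f -> b f f <= t^-1 * bt f f.
  move=> [Df Lf]; rewrite /bt mulrDr mulKf ?gt_eqF// lerDl.
  by apply: mulr_ge0; [rewrite invr_ge0 ltW|exact: (psd_ge0 L)].
have le_L f : Dom f -> ipL2 mu f f <= bt f f.
  by move=> [Df Lf]; rewrite /bt lerDr mulr_ge0 ?(ltW t0)//; exact: (psd_ge0 bP).
have DB m n := psd_domB btP (Du m) (Du n).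
have [|v Dv uv] := rk_form_complete kP (fun n => (Du n).1).
  move=> e e0; have [|n0 Hn] := uC (t * e); first exact: mulr_gt0.
  exists n0 => m n m0 nn0; apply: le_trans (le_b _ (DB m n)) _.
  by rewrite ler_pdivrMl// Hn.
have cvu x : (fun n => u n x) @ \oo --> v x.
  by apply: (@rkhs_cvg_pointwise _ _ _ kP u v x) => // n; exact: (Du n).1.
have cfib f i : rkhs k f -> continuous (fiber f i) := @rkhs_continuous f i.
have fat e : 0 < e -> exists n0, forall n, (n0 <= n)%N ->
    cL2 mu (u n - v) /\ ipL2 mu (u n - v) (u n - v) <= #|I|%:R * e.
  move=> /uC[n0 Hn]; exists n0 => n nn0.
  apply: (@cL2_fatou _ _ mu I (fun m => u n - u m) _ _ n0).
  - by move=> m; exact: (DB n m).2.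
  - by move=> i; apply: cfib; apply: (psd_domB bP) => //; exact: (Du n).1.
  - by move=> x; apply: cvgB; [exact: cvg_cst|exact: cvu].
  - by move=> m m0; apply: le_trans (le_L _ (DB n m)) _; exact: Hn.
have Lv : cL2 mu v.
  have [n0 /(_ n0 (leqnn _))[Ld _]] := fat 1 ltr01.
  have -> : v = u n0 - (u n0 - v) by rewrite subKr.
  by apply: (psd_domB L) => //; exact: (Du n0).2.
exists v => // e e0.
have [|n1 H1] := uv (e / 2 / t); first by rewrite !divr_gt0.
have [|n2 H2] := fat (e / 2 / (#|I|%:R + 1)).
  by rewrite !divr_gt0// ltr_wpDl.
exists (maxn n1 n2) => n; rewrite geq_max => /andP[/H1 h1 /H2[_ h2]].
rewrite /bt (splitr e) lerD//.
  by rewrite mulrC -ler_pdivlMr.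
apply: le_trans h2 _; have I0 : 0 <= #|I|%:R :> R by [].
have e20 : 0 <= e / 2 by rewrite ltW// divr_gt0.
rewrite mulrC mulrAC ler_pdivrMr ?ltr_wpDl//.
by rewrite ler_wpM2l// lerDl.
Qed.

(* [w] is [t (t + A)^-1 v] for the positive operator [A] with
   [b (A f) h = ipL2 f h]. *)
Let solves v w := Dom w /\ forall z, Dom z -> bt w z = t * b v z.

Let solve_ex v : exists w, rkhs k v -> solves v w.
Proof.
have [Dv|nD] := pselect (rkhs k v); last by exists v.
have [|||w Dw Hw] := @riesz _ _ Dom bt btP (fun z => t * b v z) (t * b v v) _ bt_complete.
- by apply: mulr_ge0; [exact: ltW|exact: (psd_ge0 bP)].
- move=> a f w [Df _] [Dw _]; rewrite (psdDr bP)//; last exact: (psd_domZ bP).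
  by rewrite (psdZr bP)//; ring.
- move=> f [Df Lf]; rewrite exprMn.
  have := psd_CS bP Dv Df; have := psd_ge0 L Lf; have := psd_ge0 bP Dv.
  rewrite /bt => v0 f0 H.
  have -> : t * b v v * (t * b f f + ipL2 mu f f) =
     t ^+ 2 * (b v v * b f f) + t * b v v * ipL2 mu f f by ring.
  apply: ler_wpDr; last by rewrite ler_wpM2l ?sqr_ge0.
  by apply: mulr_ge0 => //; apply: mulr_ge0 => //; exact: ltW.
by exists w.
Qed.

Let solves_uniq v w w' : rkhs k v -> solves v w -> solves v w' -> w = w'.
Proof.
move=> Dv [Dw Hw] [Dw' Hw']; have Dd := psd_domB btP Dw Dw'.
apply/eqP; rewrite -subr_eq0; apply/eqP; apply: (rkhs_definite kP Dd.1).
have : bt (w - w') (w - w') = 0 by rewrite (psdBl btP)// Hw// Hw'// subrr.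
have h1 := psd_ge0 bP Dd.1; have h2 := psd_ge0 L Dd.2.
rewrite /bt => H; apply/eqP; rewrite eq_le h1 andbT.
have : t * b (w - w') (w - w') <= 0 by lra.
by rewrite pmulr_rle0.
Qed.

Let solves_ltrans h v w : rkhs k v -> solves v w ->
  solves (v \o ltrans h : _ -> R^o) (w \o ltrans h).
Proof.
move=> Dv [[Dw Lw] Hw]; split.
  by split; [exact: (rkhs_ltrans h Dw Dw).1|exact: (cL2_ltrans mu_haar h Lw Lw).1].
move=> z [Dz Lz].
have zE : z = (z \o ltrans h^-1%g) \o ltrans h.
  by apply/funext => x; rewrite /= ltransK.
have Dz' := (rkhs_ltrans h^-1%g Dz Dz).1.
have Lz' := (cL2_ltrans mu_haar h^-1%g Lz Lz).1.
rewrite zE /bt (rkhs_ltrans h Dw Dz').2 (rkhs_ltrans h Dv Dz').2.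
by rewrite (cL2_ltrans mu_haar h Lw Lz').2; exact: Hw.
Qed.

Lemma regularize_kernel : exists Phi',
  [/\ l2_kernel Phi', bounded_kernel Phi',
      forall x, ipL2 mu (mx_kernel Phi' x : _ -> R^o) (mx_kernel Phi' x) <=
        ipL2 mu (k x : _ -> R^o) (k x)
    & forall x y, (mx_kernel Phi' x y - k x y) ^+ 2 <=
        t^-1 * ipL2 mu (k x : _ -> R^o) (k x) * k y y].
Proof.
have [E HE] := choice solve_ex.
have Dk x := rkhs_kernel kP x.
have SE x := HE _ (Dk x).
pose Phi' g i j : R := E (k (g, i)) (1%g, j).
have k'E x y : mx_kernel Phi' x y = E (k x) y.
  have := solves_ltrans y.1 (Dk x) (SE x).
  have := mx_kernel_ltransl y.1^-1%g x; rewrite invgK => -> H.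
  have := solves_uniq (Dk _) H (SE _) => /(congr1 (fun f => f (1%g, y.2))).
  by rewrite /= {1}/ltrans /= mulg1 -surjective_pairing => ->.
have solves_lin a v w v' w' : rkhs k v -> rkhs k v' -> solves v w -> solves v' w' ->
    solves (a *: v + v') (a *: w + w').
  move=> Dv Dv' [Dw Hw] [Dw' Hw']; split; first exact: (psd_lin btP).
  move=> z Dz; rewrite (psd_linl btP)// Hw// Hw'// (psd_linl bP)//; last exact: Dz.1.
  by ring.
have k'k x : mx_kernel Phi' x = E (k x) by apply/funext => y; exact: k'E.
have k'sum s : solves (ksum k s) (ksum (mx_kernel Phi') s).
  elim: s => [|p s IH].
    rewrite !ksum_nil; split; first exact: (psd_dom0 btP).
    move=> z Dz; rewrite (psd0l btP)// (psd0l bP) ?mulr0//; exact: Dz.1.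
  rewrite !ksum_cons k'k; apply: solves_lin => //; exact: rkhs_ksum.
have evE s : t * ev s (ksum (mx_kernel Phi') s) =
    bt (ksum (mx_kernel Phi') s) (ksum (mx_kernel Phi') s).
  have [Dw Hw] := k'sum s; have Ds := rkhs_ksum kP s.
  by rewrite (Hw _ Dw) (psdC bP Ds Dw.1) rk_form_ksum//; exact: Dw.1.
have k'C x y : mx_kernel Phi' x y = mx_kernel Phi' y x.
  apply: (mulfI (lt0r_neq0 t0)).
  have [Dx Hx] := SE x; have [Dy Hy] := SE y.
  rewrite !k'E -(rk_form_kernel kP y Dx.1) -(rk_form_kernel kP x Dy.1).
  rewrite (psdC bP Dx.1 (Dk y)) (psdC bP Dy.1 (Dk x)) -Hx// -Hy//.
  exact: (psdC btP).
have Phi'E i j : (fun g => Phi' g i j) = fiber (E (k (1%g, j))) i.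
  apply/funext => g; rewrite /fiber -k'E k'C /mx_kernel /=.
  by rewrite invg1 mul1g.
have opt x : let y := E (k x) in
    ipL2 mu y y <= ipL2 mu (k x : _ -> R^o) (k x) /\
    t * b (y - k x) (y - k x) <= ipL2 mu (k x : _ -> R^o) (k x).
  move=> y; have [Dy Hy] := SE x; have Lx := cL2_kernel x.
  have Dx : Dom (k x) by split; [exact: Dk|exact: Lx].
  have Dd := psd_domB btP Dy Dx; have := Hy _ Dd.
  rewrite /bt -/y (psdBr L Dy.2 Lx Dy.2).
  rewrite [b y _](_ : _ = b (y - k x) (y - k x) + b (k x) (y - k x)); last first.
    by rewrite (psdBl bP Dy.1 Dx.1 Dd.1) subrK.
  have := psd_ge0 L (psd_domB L Dy.2 Lx).
  rewrite (psdBl L Dy.2 Lx (psd_domB L Dy.2 Lx)) !(psdBr L Dy.2 Lx)//; last exact: Dy.2.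
  rewrite (psdC L Lx Dy.2); have := psd_ge0 L Dy.2; have := psd_ge0 bP Dd.1.
  have := mulr_ge0 (ltW t0) (psd_ge0 bP Dd.1).
  by move=> h1 h2 h3 h4 h5; split; lra.
exists Phi'; split.
- split.
  + by move=> i j; rewrite Phi'E; exact: (rkhs_continuous (SE _).1.1).
  + by move=> i j; rewrite Phi'E; have [_] := (SE (1%g, j)).1.2 i.
  + split => // s; rewrite -(pmulr_rge0 _ t0) evE.
    exact: (psd_ge0 btP (k'sum s).1).
- exists t => // s; rewrite evE /bt lerDr; apply: mulr_ge0; first exact: ltW.
  exact: (psd_ge0 bP (k'sum s).1.1).
- by move=> x; rewrite k'k; exact: (opt x).1.
- move=> x y; rewrite k'E; have Dd := psd_domB bP (SE x).1.1 (Dk x).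
  apply: le_trans (rkhs_eval kP y Dd) _.
  apply: ler_wpM2r.
    by rewrite -(rk_form_kernel kP y (Dk y)); exact: (psd_ge0 bP).
  by rewrite ler_pdivlMl//; exact: (opt x).2.
Qed.

End Regularize.
End Kernel.
End MatrixKernels.

(** * Positivity of the pairing *)

Section PolynomialFunctionals.
Context (R : realType).
Implicit Types (p q : {poly R}) (m : nat -> R).

Definition mom m p : R := \sum_(i < size p) p`_i * m i.

Lemma mom_widen m p n : (size p <= n)%N -> mom m p = \sum_(i < n) p`_i * m i.
Proof.
move=> pn; rewrite /mom (big_ord_widen n (fun i => p`_i * m i) pn) big_mkcond.
apply: eq_bigr => i _; case: ltnP => // pi; by rewrite nth_default// mul0r.
Qed.

Lemma momD m p q : mom m (p + q) = mom m p + mom m q.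
Proof.
pose n := maxn (size p) (size q).
rewrite (@mom_widen m _ n) ?(leq_trans (size_polyD _ _))//.
rewrite (@mom_widen m p n) ?leq_maxl// (@mom_widen m q n) ?leq_maxr//.
by rewrite -big_split; apply: eq_bigr => i _; rewrite coefD mulrDl.
Qed.

Lemma momZ m (c : R) p : mom m (c *: p) = c * mom m p.
Proof.
rewrite (@mom_widen m _ (size p)) ?size_scale_leq// mulr_sumr.
by apply: eq_bigr => i _; rewrite coefZ mulrA.
Qed.

Lemma momB m p q : mom m (p - q) = mom m p - mom m q.
Proof. by rewrite momD -scaleN1r momZ mulN1r. Qed.

Lemma mom_sum m (J : Type) (r : seq J) (F : J -> {poly R}) :
  mom m (\sum_(j <- r) F j) = \sum_(j <- r) mom m (F j).
Proof.
elim: r => [|j r IH]; first by rewrite !big_nil /mom size_poly0 big_ord0.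
by rewrite !big_cons momD IH.
Qed.

Lemma momXn m n : mom m 'X^n = m n.
Proof.
rewrite /mom size_polyXn big_ord_recr /= coefXn eqxx mul1r big1 ?add0r// => i _.
by rewrite coefXn ltn_eqF ?mul0r.
Qed.

Lemma mom1 m : mom m 1 = m 0%N.
Proof. by rewrite -(expr0 'X) momXn. Qed.

Lemma mom_prod m p q : mom m (p * q) =
  \sum_(i < size p) \sum_(j < size q) p`_i * q`_j * m (i + j)%N.
Proof.
rewrite -{1}[p]coefK -{1}[q]coefK !poly_def mulr_suml mom_sum; apply: eq_bigr => i _.
rewrite mulr_sumr mom_sum; apply: eq_bigr => j _.
by rewrite -scalerAl -scalerAr scalerA -exprD momZ momXn.
Qed.

Lemma mom_mulX m p : mom m ('X * p) = mom (fun n => m n.+1) p.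
Proof.
rewrite mulrC (@mom_widen m _ (size p).+1).
  rewrite big_ord_recl coefMX /= mul0r add0r; apply: eq_bigr => i _.
  by rewrite coefMX.
have [->|p0] := eqVneq p 0; first by rewrite mul0r size_poly0.
by rewrite size_mulX.
Qed.

(* With [x = 'X * q n], this is F. Riesz' iteration [x <- x - x ^+ 2], which
   writes ['X] as the sum of the squares of its successive iterates. *)
Fixpoint riesz_poly (n : nat) : {poly R} :=
  if n is n'.+1 then riesz_poly n' - 'X * riesz_poly n' ^+ 2 else 1.

Definition unit_interval_functional m := forall p,
  [/\ 0 <= mom m (p ^+ 2), 0 <= mom m ('X * p ^+ 2)
    & 0 <= mom m ((1 - 'X) * p ^+ 2)].

Let uif_shift m : unit_interval_functional m ->
  unit_interval_functional (fun n => m n.+1).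
Proof.
move=> mP p; rewrite -!mom_mulX; split.
- by have [] := mP p.
- by have [+ _ _] := mP ('X * p); congr (0 <= mom m _); ring.
- have [_ h1 _] := mP ((1 - 'X) * p); have [_ _ h2] := mP ('X * p).
  by have := addr_ge0 h1 h2; rewrite -momD; congr (0 <= mom m _); ring.
Qed.

Let riesz_iterate_ge0 m n p : unit_interval_functional m ->
  0 <= mom m ('X * riesz_poly n * p ^+ 2) /\
  0 <= mom m ((1 - 'X * riesz_poly n) * p ^+ 2).
Proof.
move=> mP; elim: n p => [|n IH] p /=.
  by rewrite mulr1; have [] := mP p.
have [h1 _] := IH ((1 - 'X * riesz_poly n) * p).
have [_ h2] := IH (('X * riesz_poly n) * p).
have [_ h3] := IH p; have [h4 _ _] := mP (('X * riesz_poly n) * p).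
split.
  by have := addr_ge0 h1 h2; rewrite -momD; congr (0 <= mom m _); ring.
by have := addr_ge0 h3 h4; rewrite -momD; congr (0 <= mom m _); ring.
Qed.

Lemma riesz_poly_ge0 m n p : unit_interval_functional m ->
  0 <= mom m (riesz_poly n * p ^+ 2).
Proof.
move=> mP; elim: n p => [|n IH] p /=; first by rewrite mul1r; have [] := mP p.
have h1 := IH ((1 - 'X * riesz_poly n) * p).
have [_] := riesz_iterate_ge0 n (riesz_poly n * p) (uif_shift mP).
rewrite -mom_mulX => h2.
by have := addr_ge0 h1 h2; rewrite -momD; congr (0 <= mom m _); ring.
Qed.

Lemma riesz_poly_sum m n : m 0%N =
  \sum_(i < n) mom m ('X * riesz_poly i ^+ 2) + mom m (riesz_poly n).
Proof.
elim: n => [|n IH]; first by rewrite big_ord0 add0r mom1.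
by rewrite IH big_ord_recr /= momB; ring.
Qed.

Lemma riesz_poly_small m e : unit_interval_functional m -> 0 < e ->
  exists n, mom m ('X * riesz_poly n ^+ 2) <= e.
Proof.
move=> mP e0; apply: contrapT => H.
pose n := (Num.trunc (m 0%N / e)).+1.
have : n%:R * e <= m 0%N.
  rewrite (riesz_poly_sum m n); apply: ler_wpDr.
    by have := riesz_poly_ge0 n 1 mP; rewrite expr1n mulr1.
  rewrite mulr_natl -[n in leLHS]card_ord -sumr_const; apply: ler_sum => i _.
  by rewrite leNgt; apply/negP => lt; apply: H; exists i; exact: ltW.
by rewrite leNgt -ltr_pdivrMr// truncnS_gt.
Qed.

End PolynomialFunctionals.

Section BoundedKernels.
Context (R : realType) (G : topGroupType)
  (mu : {measure set (borel G) -> \bar R}) (I : finType).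
Hypothesis hausG : hausdorff_space G.
Hypothesis mu_haar : haar_measure mu.
Implicit Types (Phi Psi : G -> I -> I -> R).
Let L := @cL2_psd R G mu I.

Lemma bounded_kernel_form Phi : l2_kernel mu Phi -> bounded_kernel mu Phi ->
  exists2 C : R, 0 < C & forall f, rkhs (mx_kernel Phi) f -> cL2 mu f /\
    ipL2 mu f f <= C * rk_form (mx_kernel Phi) f f.
Proof.
move=> PhiP [C C0 HC]; have kP := l2k_psd PhiP; have bP := rk_form_psd kP.
set k := mx_kernel Phi in kP bP HC *; set b := rk_form k in bP *.
have Lsum s : cL2 mu (ksum k s).
  elim: s => [|p s IH]; first by rewrite ksum_nil; exact: (psd_dom0 L).
  by rewrite ksum_cons; apply: (psd_lin L) => //; exact: cL2_kernel.
exists (#|I|%:R * (4 * C) + 1); first by rewrite ltr_wpDl// !mulr_ge0// ltW.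
move=> f Df; have f0 := psd_ge0 bP Df.
have [bf0|bf0] := eqVneq (b f f) 0.
  have -> : f = 0 by exact: (rkhs_definite kP Df bf0).
  rewrite (psd0l L (psd_dom0 L)) (psd0l bP (psd_dom0 bP)) mulr0.
  by split => //; exact: (psd_dom0 L).
have {}bf0 : 0 < b f f by rewrite lt_def bf0.
have /choice[s Hs] : forall n : nat, exists s, b (f - ksum k s) (f - ksum k s) < b f f / n.+1%:R.
  by move=> n; apply: rkhs_dense => //; rewrite divr_gt0.
have Ds n := rkhs_ksum kP (s n).
have Dd n := psd_domB bP Df (Ds n).
have cv x : (fun n => ksum k (s n) x) @ \oo --> f x.
  apply: (@rkhs_cvg_pointwise _ _ _ kP (fun n => ksum k (s n)) f x Ds Df) => e e0.
  exists (Num.trunc (b f f / e)) => n nn.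
  have E := psd_distC bP (Ds n) Df; apply: le_trans (_ : _ <= b _ _) _.
    by rewrite le_eqVlt; apply/orP; left; apply/eqP; exact: E.
  apply: le_trans (ltW (Hs n)) _; rewrite ler_pdivrMr// mulrC -ler_pdivrMr//.
  by apply: le_trans (ltW (truncnS_gt _)) _; rewrite ler_nat ltnS.
have [|||Lf Nf] := @cL2_fatou R G mu I (fun n => ksum k (s n)) f (4 * C * b f f) 0%N _ _ cv.
- by move=> n; exact: Lsum.
- by move=> i; exact: (rkhs_continuous PhiP).
- move=> n _; apply: le_trans (HC _) _; rewrite -(rk_form_ksum kP _ (Ds n)) -/b.
  rewrite [4 * C]mulrC -mulrA ler_wpM2l ?(ltW C0)//.
  have Hn : b (f - ksum k (s n)) (f - ksum k (s n)) <= b f f.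
    apply: le_trans (ltW (Hs n)) _; rewrite ler_pdivrMr// ler_peMr//.
    by rewrite ler1n.
  by have := psd_subl_le bP Df (Ds n); rewrite -/b; lra.
split => //; apply: le_trans Nf _.
by rewrite [leRHS]mulrDl mul1r mulrA lerDl.
Qed.

Section Operators.
Variables (Phi Psi : G -> I -> I -> R) (C C' : R).
Hypotheses (PhiP : l2_kernel mu Phi) (PsiP : l2_kernel mu Psi).
Local Notation k := (mx_kernel Phi).
Local Notation k' := (mx_kernel Psi).
Local Notation D := (rkhs k).
Local Notation D' := (rkhs k').
Local Notation b := (rk_form k).
Local Notation b' := (rk_form k').
Local Notation N := (ipL2 mu).
Hypotheses (C0 : 0 < C) (C'0 : 0 < C').
Hypothesis NC : forall f, D f -> cL2 mu f /\ N f f <= C * b f f.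
Hypothesis NC' : forall f, D' f -> cL2 mu f /\ N f f <= C' * b' f f.
Let kP : psd_kernel k := l2k_psd PhiP.
Let k'P : psd_kernel k' := l2k_psd PsiP.
Let bP : psd_form D b := rk_form_psd kP.
Let b'P : psd_form D' b' := rk_form_psd k'P.
Let kap i : G * I -> R^o := k (1%g, i).
Let lam i : G * I -> R^o := k' (1%g, i).

Let B_ex v : exists w, D v -> D w /\ forall z, D z -> b w z = C^-1 * N v z.
Proof.
have [Dv|?] := pselect (D v); last by exists v.
have [Lv Nv] := NC Dv.
have [||||w Dw Hw] := @riesz _ _ D b bP (fun z => C^-1 * N v z) (b v v).
- exact: (psd_ge0 bP).
- exact: rk_form_complete.
- move=> a f g Df Dg; rewrite (psdDr L)//; [|exact: (psd_domZ L _ (NC Df).1)|exact: (NC Dg).1].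
  by rewrite (psdZr L)//; [ring|exact: (NC Df).1].
- move=> f Df; have [Lf Nf] := NC Df; rewrite exprMn.
  apply: le_trans (ler_wpM2l (sqr_ge0 _) (psd_CS L Lv Lf)) _.
  have := ler_pM (psd_ge0 L Lv) (psd_ge0 L Lf) Nv Nf.
  have -> : C * b v v * (C * b f f) = C ^+ 2 * (b v v * b f f) by ring.
  by rewrite exprVn ler_pdivrMl// exprn_gt0.
by exists w.
Qed.

Let Theta_ex v : exists w, D v -> D' w /\ forall z, D' z -> b' w z = N v z.
Proof.
have [Dv|?] := pselect (D v); last by exists v.
have [Lv Nv] := NC Dv.
have [||||w Dw Hw] := @riesz _ _ D' b' b'P (fun z => N v z) (N v v * C').
- by apply: mulr_ge0; [exact: (psd_ge0 L)|exact: ltW].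
- exact: rk_form_complete.
- move=> a f g Df Dg; rewrite (psdDr L)//; [|exact: (psd_domZ L _ (NC' Df).1)|exact: (NC' Dg).1].
  by rewrite (psdZr L)//; exact: (NC' Df).1.
- move=> f Df; have [Lf Nf] := NC' Df.
  apply: le_trans (psd_CS L Lv Lf) _; rewrite -mulrA; apply: ler_wpM2l => //.
  exact: (psd_ge0 L).
by exists w.
Qed.

Let eta_ex i : exists w, D w /\ forall v, D v -> b v w = N v (lam i).
Proof.
have Dl := rkhs_kernel k'P (1%g, i); have [Ll _] := NC' Dl.
have [||||w Dw Hw] := @riesz _ _ D b bP (fun z => N z (lam i)) (C * N (lam i) (lam i)).
- by apply: mulr_ge0; [exact: ltW|exact: (psd_ge0 L)].
- exact: rk_form_complete.
- move=> a f g Df Dg; rewrite (psd_linl L)//; [exact: (NC Df).1|exact: (NC Dg).1].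
- move=> f Df; have [Lf Nf] := NC Df.
  apply: le_trans (psd_CS L Lf Ll) _; rewrite mulrAC; apply: ler_wpM2r => //.
  exact: (psd_ge0 L).
by exists w; split => // v Dv; rewrite (psdC bP)// Hw.
Qed.

Lemma bounded_form_positivity : 0 <= \sum_i N (kap i) (lam i).
Proof.
have [B HB] := choice B_ex; have [Th HTh] := choice Theta_ex.
have [eta Heta] := choice eta_ex.
have Dk i : D (kap i) := rkhs_kernel kP _.
have Dl i : D' (lam i) := rkhs_kernel k'P _.
have DB v : D v -> D (B v) by move=> /HB[].
have DBn n v : D v -> D (iter n B v) by move=> Dv; elim: n => //= n; exact: DB.
have BE v w : D v -> D w -> b (B v) w = C^-1 * N v w by move=> /HB[_ H] /H.
have BC v w : D v -> D w -> b (B v) w = b v (B w).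
  move=> Dv Dw; rewrite (psdC bP Dv (DB _ Dw)) !BE// (psdC L)//;
    [exact: (NC Dv).1|exact: (NC Dw).1].
have BnC n v w : D v -> D w -> b (iter n B v) w = b v (iter n B w).
  elim: n v w => //= n IH v w Dv Dw; rewrite BC ?IH//; [|exact: DB|exact: DBn].
  by rewrite -iterSr.
pose pB (p : {poly R}) v := \sum_(i < size p) p`_i *: iter i B v.
have DpB p v : D v -> D (pB p v).
  move=> Dv; apply: (psd_sumr bP _ _ Dv).1 => i.
  by apply: (psd_domZ bP); exact: DBn.
have pBl p v w : D v -> D w -> b (pB p v) w = \sum_(i < size p) p`_i * b (iter i B v) w.
  move=> Dv Dw; rewrite (psd_suml bP)//; last by move=> i; apply: (psd_domZ bP); exact: DBn.
  by apply: eq_bigr => i _; rewrite (psdZl bP)//; exact: DBn.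
have pBC p v w : D v -> D w -> b (pB p v) w = b v (pB p w).
  move=> Dv Dw; rewrite (psdC bP Dv (DpB _ _ Dw)) !pBl//; apply: eq_bigr => i _.
  by rewrite BnC// (psdC bP)//; exact: DBn.
have pB2 p q v w : D v -> D w ->
    b (pB p v) (pB q w) = mom (fun n => b (iter n B v) w) (p * q).
  move=> Dv Dw; rewrite mom_prod pBl//; last exact: DpB.
  apply: eq_bigr => i _; rewrite -pBC//; last exact: DBn.
  rewrite pBl//; last exact: DBn.
  rewrite mulr_sumr; apply: eq_bigr => j _; rewrite mulrA; congr (_ * _).
  by rewrite -iterD addnC.
have eqD u v : D u -> D v -> (forall w, D w -> b u w = b v w) -> u = v.
  move=> Du Dv uv; have Dd := psd_domB bP Du Dv.
  apply/eqP; rewrite -subr_eq0; apply/eqP; apply: (rkhs_definite kP Dd).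
  by rewrite (psdBl bP)// uv// subrr.
have pBB p v : D v -> pB p (B v) = B (pB p v).
  move=> Dv; apply: eqD => [||w Dw]; [exact/DpB/DB|exact/DB/DpB|].
  rewrite BC//; last exact: DpB.
  rewrite !pBl//; [|exact: DB|exact: DB].
  by apply: eq_bigr => i _; rewrite -iterSr /= BC//; exact: DBn.
have Dt h v : D v -> D (v \o ltrans h : _ -> R^o) by move=> Dv; exact: (rkhs_ltrans h Dv Dv).1.
have bt h v w : D v -> D w ->
    b (v \o ltrans h : _ -> R^o) w = b v (w \o ltrans h^-1%g).
  move=> Dv Dw; rewrite -(rkhs_ltrans h Dv (Dt h^-1%g _ Dw)).2; congr (b _ _).
  by apply/funext => x; rewrite /= ltransK.
have Nt h v w : cL2 mu v -> cL2 mu w ->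
    N (v \o ltrans h : _ -> R^o) w = N v (w \o ltrans h^-1%g).
  move=> Lv Lw; have Lw' := (cL2_ltrans mu_haar h^-1%g Lw Lw).1.
  rewrite -(cL2_ltrans mu_haar h Lv Lw').2; congr (N _ _).
  by apply/funext => x; rewrite /= ltransK.
have tB h v : D v -> B (v \o ltrans h : _ -> R^o) = B v \o ltrans h.
  move=> Dv; apply: eqD => [||w Dw]; [exact/DB/Dt|exact/Dt/DB|].
  have Dw' := Dt h^-1%g _ Dw.
  rewrite bt//; last exact: DB.
  rewrite !BE//; last exact: Dt.
  by rewrite Nt//; [exact: (NC Dv).1|exact: (NC Dw).1].
have tBn h n v : D v -> iter n B (v \o ltrans h : _ -> R^o) = iter n B v \o ltrans h.
  by move=> Dv; elim: n => //= n ->; rewrite tB//; exact: DBn.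
have tpB h p v : D v -> pB p (v \o ltrans h : _ -> R^o) = pB p v \o ltrans h.
  move=> Dv; apply: eqD => [||w Dw]; [exact/DpB/Dt|exact/Dt/DpB|].
  have Dw' := Dt h^-1%g _ Dw.
  rewrite bt//; last exact: DpB.
  rewrite !pBl//; last exact: Dt.
  by apply: eq_bigr => i _; rewrite tBn// bt//; exact: DBn.
have mom_exch (f : I -> nat -> R) p : mom (fun n => \sum_i f i n) p = \sum_i mom (f i) p.
  rewrite /mom; under eq_bigr do rewrite mulr_sumr.
  by rewrite exchange_big.
pose m n := \sum_i b (iter n B (kap i)) (kap i).
have mE p q : mom m (p * q) = \sum_i b (pB p (kap i)) (pB q (kap i)).
  by rewrite /m mom_exch; apply: eq_bigr => i _; rewrite pB2.
have m1E p q : mom (fun n => m n.+1) (p * q) = C^-1 * \sum_i N (pB p (kap i)) (pB q (kap i)).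
  rewrite /m mom_exch mulr_sumr; apply: eq_bigr => i _.
  rewrite -BE; [|exact: DpB|exact: DpB].
  rewrite -pBB// pB2//; last exact: DB.
  by congr (mom _ _); apply/funext => n; rewrite -iterSr.
have mP : unit_interval_functional m.
  move=> p; rewrite expr2 mulrBl mul1r momB mom_mulX m1E mE; split.
  - by apply: sumr_ge0 => i _; apply: (psd_ge0 bP); exact: DpB.
  - rewrite mulr_ge0 ?invr_ge0 ?(ltW C0)//; apply: sumr_ge0 => i _; apply: (psd_ge0 L).
    exact: (NC (DpB _ _ (Dk i))).1.
  - rewrite mulr_sumr -sumrB; apply: sumr_ge0 => i _; rewrite subr_ge0 ler_pdivrMl//.
    exact: (NC (DpB _ _ (Dk i))).2.
pose M n := \sum_i N (iter n B (kap i)) (lam i).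
have momM p : mom M p = \sum_i N (pB p (kap i)) (lam i).
  rewrite /M mom_exch; apply: eq_bigr => i _.
  have [De He] := Heta i.
  rewrite -He ?pBl//; last exact: DpB.
  by apply: eq_bigr => n _; rewrite He//; exact: DBn.
have main p : 0 <= mom M ('X * p ^+ 2).
  rewrite expr2 mom_mulX /M mom_exch.
  pose y i := pB p (kap i).
  have Dy i : D (y i) by exact: DpB.
  have De i : D (eta i) := (Heta i).1.
  have kE g i : k (g, i) = kap i \o ltrans g^-1%g.
    by rewrite mx_kernel_ltransl /ltrans /= mulg1.
  have yE i g l : y l (g, i) = y i (g^-1%g, l).
    rewrite -(rk_form_kernel kP (g, i) (Dy l)) kE pBC//; last exact: Dt.
    rewrite tpB// (psdC bP)//; last exact/Dt/Dy.
    rewrite rk_form_kernel//; last exact/Dt/Dy.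
    by rewrite /= /ltrans /= mulg1.
  have eE l g i : pB p (eta l) (g, i) = Th (y i) (g^-1%g, l).
    rewrite -(rk_form_kernel kP (g, i) (DpB _ _ (De l))) kE pBC//; last exact: Dt.
    have Dyt := Dt g^-1%g _ (Dy i); have [DTh HT] := HTh _ (Dy i).
    rewrite tpB// (psdC bP)// (Heta l).2// Nt//; [|exact: (NC (Dy i)).1|exact: (NC' (Dl l)).1].
    rewrite mx_kernel_ltransl -HT; last exact: rkhs_kernel.
    by rewrite rk_form_kernel// /ltrans /= mulg1.
  have E l : mom (fun n => N (iter n.+1 B (kap l)) (lam l)) (p * p) =
      C^-1 * N (y l) (pB p (eta l)).
    rewrite -BE; [|exact: Dy|exact: DpB].
    rewrite -pBB// pB2//; last exact: DB.
    congr (mom _ _); apply/funext => n; rewrite -(Heta l).2; last exact: (DBn n.+1).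
    by rewrite -iterSr.
  under eq_bigr do rewrite E.
  rewrite -mulr_sumr mulr_ge0 ?invr_ge0 ?(ltW C0)//.
  have -> : \sum_l N (y l) (pB p (eta l)) = \sum_i N (y i) (Th (y i)).
    rewrite /ipL2 exchange_big; apply: eq_bigr => i _; apply: eq_bigr => l _.
    have [DTh _] := HTh _ (Dy i).
    have Ly := (NC (Dy i)).1; have LT := (NC' DTh).1.
    have Le := (NC (DpB p _ (De l))).1; have Lyl := (NC (Dy l)).1.
    have FE : (fun g => y l (g, i) * pB p (eta l) (g, i)) =
        (fun g => y i (g^-1%g, l) * Th (y i) (g^-1%g, l)).
      by apply/funext => g; rewrite yE eE.
    have I1 := cL2_integrable i Lyl Le; rewrite FE in I1 *.
    apply: (Rintegral_inv hausG mu_haar (f := fun g => y i (g, l) * Th (y i) (g, l))) => //.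
      by move=> g; apply: cvgM; [exact: (Ly l).1|exact: (LT l).1].
    exact: cL2_integrable.
  apply: sumr_ge0 => i _; have [DTh HT] := HTh _ (Dy i).
  by rewrite -HT//; exact: (psd_ge0 b'P).
rewrite (_ : \sum_i N (kap i) (lam i) = M 0%N)//.
apply/ler_addgt0Pr => e e0.
pose S := \sum_i N (lam i) (lam i).
have Ll i : cL2 mu (lam i) := (NC' (Dl i)).1.
have S0 : 0 <= S by apply: sumr_ge0 => i _; exact: (psd_ge0 L).
pose a := (S + 1) / e.
have a0 : 0 < a by rewrite divr_gt0// ltr_wpDl.
have aC0 : 0 < a * C by exact: mulr_gt0.
have [|n Hn] := @riesz_poly_small R m (e / (a * C)) mP; first exact: divr_gt0.
have sum0 : 0 <= \sum_(i < n) mom M ('X * riesz_poly R i ^+ 2).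
  by apply: sumr_ge0 => i _; exact: main.
rewrite (riesz_poly_sum M n) -addrA addr_ge0//.
pose y i := pB (riesz_poly R n) (kap i).
have Ly i : cL2 mu (y i) by exact: (NC (DpB _ _ (Dk i))).1.
have low i : - (a * N (y i) (y i) + N (lam i) (lam i) / a) <= 2 * N (y i) (lam i).
  have := psd_ge0 L (psd_domD L (Ll i) (psd_domZ L a (Ly i))).
  rewrite (psd_expand L)// (psdC L (Ll i) (Ly i)) => H.
  rewrite -(ler_pM2l a0).
  have -> : a * - (a * N (y i) (y i) + N (lam i) (lam i) / a) =
      - (a ^+ 2 * N (y i) (y i) + N (lam i) (lam i)) by field; rewrite gt_eqF.
  by lra.
have Sy : a * \sum_i N (y i) (y i) <= e.
  move: Hn; rewrite expr2 mom_mulX m1E ler_pdivlMr// -/y.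
  by rewrite mulrC -mulrA [C * _]mulrA mulfV ?gt_eqF// mul1r.
have Se : S / a <= e.
  by rewrite ler_pdivrMr// /a mulrC divfK ?gt_eqF// lerDl.
have : - (a * (\sum_i N (y i) (y i)) + S / a) <= 2 * mom M (riesz_poly R n).
  rewrite momM !mulr_sumr mulr_suml -big_split -sumrN; apply: ler_sum => i _.
  exact: low.
by lra.
Qed.

End Operators.

Theorem bounded_kernel_positivity Phi Psi :
  l2_kernel mu Phi -> bounded_kernel mu Phi ->
  l2_kernel mu Psi -> bounded_kernel mu Psi ->
  0 <= \sum_i ipL2 mu (mx_kernel Phi (1%g, i) : _ -> R^o) (mx_kernel Psi (1%g, i)).
Proof.
move=> PhiP Phib PsiP Psib.
have [C C0 HC] := bounded_kernel_form PhiP Phib.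
have [C' C'0 HC'] := bounded_kernel_form PsiP Psib.
exact: (bounded_form_positivity PhiP PsiP C0 C'0 HC HC').
Qed.

End BoundedKernels.

Section KernelPositivity.
Context (R : realType) (G : topGroupType)
  (mu : {measure set (borel G) -> \bar R}) (I : finType).
Hypothesis hausG : hausdorff_space G.
Hypothesis mu_haar : haar_measure mu.
Implicit Types (Phi Psi : G -> I -> I -> R).
Let L := @cL2_psd R G mu I.
Let kap Phi i : G * I -> R^o := mx_kernel Phi (1%g, i).

Let regularize_pairing Phi (F : I -> G * I -> R^o) (e : R) :
  l2_kernel mu Phi -> (forall i, cL2 mu (F i)) -> 0 < e ->
  exists Phi', [/\ l2_kernel mu Phi', bounded_kernel mu Phi' &
    `|\sum_i ipL2 mu (kap Phi' i) (F i) - \sum_i ipL2 mu (kap Phi i) (F i)| <= e].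
Proof.
move=> PhiP LF e0; have Lk i : cL2 mu (kap Phi i) := cL2_kernel mu_haar PhiP _.
pose e' := e / (#|I|%:R + 1).
have e'0 : 0 < e' by rewrite divr_gt0// ltr_wpDl.
pose N i := ipL2 mu (kap Phi i) (kap Phi i).
have N0 i : 0 <= N i by exact: (psd_ge0 L).
have /choice[d Hd] : forall i, exists d, 0 < d /\ forall u, cL2 mu u ->
    ipL2 mu u u <= 4 * N i -> (forall x, `|u x| <= d) -> `|ipL2 mu (F i) u| <= e'.
  by move=> i; have [d d0 Hd] := cL2_weak (4 * N i) (LF i) e'0; exists d.
pose Kx i := Phi 1%g i i.
have Kx0 i : 0 <= Kx i.
  have kP := l2k_psd PhiP; have Dx := rkhs_kernel kP (1%g, i).
  have := psd_ge0 (rk_form_psd kP) Dx; rewrite rk_form_kernel//.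
  by rewrite /mx_kernel mulVg.
pose K := \sum_i Kx i.
have KK i : Kx i <= K by rewrite /K (bigD1 i)//= lerDl sumr_ge0.
have K0 : 0 <= K by apply: sumr_ge0.
pose t0 i := N i * K / d i ^+ 2.
have t00 i : 0 <= t0 i by apply: divr_ge0; [exact: mulr_ge0|exact: sqr_ge0].
pose t := \sum_i t0 i + 1.
have tgt : 0 < t by rewrite ltr_wpDl ?sumr_ge0.
have tt i : t0 i <= t by rewrite /t (bigD1 i)//= -addrA lerDl addr_ge0 ?sumr_ge0.
have [Phi' [P1 P2 P3 P4]] := regularize_kernel mu_haar PhiP tgt.
exists Phi'; split => //.
have Lk' i : cL2 mu (kap Phi' i) := cL2_kernel mu_haar P1 _.
rewrite -sumrB; apply: le_trans (ler_norm_sum _ _ _) _.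
apply: (@le_trans _ _ (\sum_(i : I) e')); last first.
  rewrite sumr_const -mulr_natl /e' mulrA ler_pdivrMr ?ltr_wpDl// mulrC.
  by rewrite ler_wpM2l ?(ltW e0)// lerDl.
apply: ler_sum => i _.
rewrite -(psdBl L)// (psdC L)//; last exact: (psd_domB L).
have [d0 Hdi] := Hd i; apply: Hdi; first exact: (psd_domB L).
  rewrite -(scaleN1r (kap Phi i)).
  have := psd_ge0 L (psd_domD L (Lk' i) (Lk i)).
  rewrite -{1 2}(scale1r (kap Phi i)) !(psd_expand L)//.
  have := P3 (1%g, i); rewrite -!/(kap _ i) -!/(N i); lra.
move=> x; have := P4 (1%g, i) x; rewrite -/(kap Phi i) -/(N i).
have -> : mx_kernel Phi x x = Kx x.2 by rewrite /mx_kernel mulVg.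
move=> H; rewrite -ler_sqr ?nnegrE ?(ltW d0)// real_normK ?num_real//.
apply: le_trans H _; rewrite -mulrA ler_pdivrMl// mulrC.
apply: (@le_trans _ _ (N i * K)).
  by rewrite mulrC ler_wpM2l.
by have := tt i; rewrite /t0 ler_pdivrMr ?exprn_gt0.
Qed.

Theorem kernel_positivity Phi Psi : l2_kernel mu Phi -> l2_kernel mu Psi ->
  0 <= \sum_i ipL2 mu (kap Phi i) (kap Psi i).
Proof.
have half Phi1 Psi1 : l2_kernel mu Phi1 -> l2_kernel mu Psi1 -> bounded_kernel mu Psi1 ->
    0 <= \sum_i ipL2 mu (kap Phi1 i) (kap Psi1 i).
  move=> Phi1P Psi1P Psi1b; apply/ler_addgt0Pr => e e0.
  have LF i : cL2 mu (kap Psi1 i) := cL2_kernel mu_haar Psi1P _.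
  have [Phi' [P1 P2]] := regularize_pairing Phi1P LF e0.
  have := bounded_kernel_positivity hausG mu_haar P1 P2 Psi1P Psi1b.
  by rewrite ler_norml => H /andP[_ ]; rewrite -/(kap _ _); lra.
move=> PhiP PsiP; apply/ler_addgt0Pr => e e0.
have LF i : cL2 mu (kap Phi i) := cL2_kernel mu_haar PhiP _.
have [Psi' [P1 P2]] := regularize_pairing PsiP LF e0.
have E Psi1 : l2_kernel mu Psi1 -> \sum_i ipL2 mu (kap Phi i) (kap Psi1 i) =
    \sum_i ipL2 mu (kap Psi1 i) (kap Phi i).
  by move=> Psi1P; apply: eq_bigr => i _; rewrite (psdC L)//; exact: cL2_kernel.
by rewrite ler_norml => /andP[_]; have := half _ _ PhiP P1 P2; rewrite !E//; lra.
Qed.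

End KernelPositivity.

(** * Complex kernels and matrix coefficients *)

Section ComplexKernels.
Context (R : realType) (G : topGroupType)
  (mu : {measure set (borel G) -> \bar R}) (I : finType).
Hypothesis hausG : hausdorff_space G.
Hypothesis mu_haar : haar_measure mu.
Implicit Types (M : G -> I -> I -> R[i]).
Local Notation Re := complex.Re.
Local Notation Im := complex.Im.

Lemma complex_ReM (x y : R[i]) : Re (x * y) = Re x * Re y - Im x * Im y.
Proof. by case: x y => [a b] [c d]. Qed.

Lemma complex_ImM (x y : R[i]) : Im (x * y) = Re x * Im y + Im x * Re y.
Proof. by case: x y => [a b] [c d]. Qed.

Lemma complex_ReD (x y : R[i]) : Re (x + y) = Re x + Re y.
Proof. by case: x y => [a b] [c d]. Qed.

Lemma complex_ImD (x y : R[i]) : Im (x + y) = Im x + Im y.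
Proof. by case: x y => [a b] [c d]. Qed.

Lemma complex_Re_sum (J : Type) (r : seq J) (F : J -> R[i]) :
  Re (\sum_(j <- r) F j) = \sum_(j <- r) Re (F j).
Proof. by elim: r => [|j r IH]; rewrite ?big_nil// !big_cons complex_ReD IH. Qed.

Lemma complex_Im_sum (J : Type) (r : seq J) (F : J -> R[i]) :
  Im (\sum_(j <- r) F j) = \sum_(j <- r) Im (F j).
Proof. by elim: r => [|j r IH]; rewrite ?big_nil// !big_cons complex_ImD IH. Qed.

Lemma complex_ge0 (x : R[i]) : (0 <= x) = (Im x == 0) && (0 <= Re x).
Proof. by rewrite lecE /= eq_sym. Qed.

Record cx_kernel M : Prop := {
  cxk_Re : forall i j, continuous (fun g => Re (M g i j)) /\
    (int_sq mu (fun g => Re (M g i j)) < +oo)%E ;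
  cxk_Im : forall i j, continuous (fun g => Im (M g i j)) /\
    (int_sq mu (fun g => Im (M g i j)) < +oo)%E ;
  cxk_conj : forall g i j, M g^-1%g i j = (M g j i)^*%C ;
  cxk_ge0 : forall s : seq (R[i] * (G * I)),
    0 <= \sum_(p <- s) \sum_(q <- s)
      p.1 * (q.1)^*%C * M (q.2.1^-1 * p.2.1)%g p.2.2 q.2.2 }.

Let opp_cont (f : G -> R) : continuous f /\ (int_sq mu f < +oo)%E ->
  continuous (fun g => - f g) /\ (int_sq mu (fun g => - f g)%R < +oo)%E.
Proof.
move=> [cf foo]; split; first by move=> g; apply: cvgN; exact: cf.
by rewrite /int_sq; under eq_integral do rewrite sqrrN.
Qed.

Let conj_sum (J : Type) (r : seq J) (F : J -> R[i]) :
  (\sum_(j <- r) F j)^*%C = \sum_(j <- r) (F j)^*%C.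
Proof. exact: raddf_sum. Qed.

Lemma cx_kernel_conj M : cx_kernel M -> cx_kernel (fun g i j => (M g i j)^*%C).
Proof.
have ReC (x : R[i]) : Re x^*%C = Re x by case: x.
have ImC (x : R[i]) : Im x^*%C = - Im x by case: x.
move=> MP; split.
- by move=> i j; under eq_fun do rewrite ReC; exact: (cxk_Re MP).
- move=> i j; under eq_fun do rewrite ImC; apply: opp_cont; exact: (cxk_Im MP).
- by move=> g i j; rewrite (cxk_conj MP).
- move=> s; have := cxk_ge0 MP [seq (p.1^*%C, p.2) | p <- s].
  have conj_ge0 (x : R[i]) : 0 <= x -> 0 <= x^*%C.
    by rewrite !complex_ge0; case: x => a b /=; rewrite oppr_eq0.
  move=> /conj_ge0; rewrite conj_sum big_map => H.
  apply: le_trans H _; rewrite le_eqVlt; apply/orP; left; apply/eqP.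
  apply: eq_bigr => p _; rewrite conj_sum big_map; apply: eq_bigr => q _ /=.
  by rewrite !rmorphM /= !conjcK.
Qed.

(* The real kernel of [Re (i^a * conj (i^b) * M)], for the vectors [v] and
   [i v] of the underlying real space. *)
Definition realify M : G -> I * bool -> I * bool -> R := fun g a b =>
  if a.2 == b.2 then Re (M g a.1 b.1) else (-1) ^+ a.2 * Im (M g a.1 b.1).

Lemma realify_l2_kernel M : cx_kernel M -> l2_kernel mu (realify M).
Proof.
move=> MP.
have cs a b : continuous (fun g => realify M g a b) /\
    (int_sq mu (fun g => realify M g a b) < +oo)%E.
  case: a b => [i [|]] [j [|]]; rewrite /realify /=; try exact: (cxk_Re MP).
    by under eq_fun do rewrite expr1 mulN1r; apply: opp_cont; exact: (cxk_Im MP).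
  by under eq_fun do rewrite expr0 mul1r; exact: (cxk_Im MP).
split; [by move=> a b; have [] := cs a b|by move=> a b; have [] := cs a b|].
pose gam (e : bool) : R[i] := if e then Complex 0 1 else 1.
have gamE g a b : realify M g a b = Re (gam a.2 * (gam b.2)^*%C * M g a.1 b.1).
  case: a b => [i [|]] [j [|]]; rewrite /realify /= /gam; case: (M g i j) => x y /=;
    by rewrite ?expr1 ?expr0; ring.
split.
  move=> x y; rewrite /mx_kernel /realify eq_sym.
  have -> : (x.1^-1 * y.1 = (y.1^-1 * x.1)^-1)%g by rewrite invgM invgK.
  rewrite (cxk_conj MP).
  by case: (M _ _ _) => u v; case: x.2.2 y.2.2 => [] [] /=; rewrite ?expr1 ?expr0; ring.
move=> s; have := cxk_ge0 MP [seq (p.1%:C%C * gam p.2.2.2, (p.2.1, p.2.2.1)) | p <- s].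
rewrite complex_ge0 => /andP[_]; rewrite complex_Re_sum big_map.
move=> H; apply: le_trans H _; rewrite le_eqVlt; apply/orP; left; apply/eqP.
rewrite /ev /ksum; under [RHS]eq_bigr do rewrite mulr_sumr.
rewrite [RHS]exchange_big; apply: eq_bigr => p _; rewrite complex_Re_sum big_map.
apply: eq_bigr => q _; rewrite /mx_kernel gamE /=.
move: (M _ _ _) => z; rewrite mulrA.
by case: (gam _) => u u'; case: (gam _) => v v'; case: z => z z' /=; ring.
Qed.

Theorem cx_kernel_positivity M1 M2 : cx_kernel M1 -> cx_kernel M2 ->
  let phi := fun g => \sum_i \sum_j M1 g i j * M2 g i j in
  cintegrable mu phi /\ 0 <= cintegral mu phi.
Proof.
move=> P1 P2 phi.
have mulI (f w : G -> R) : continuous f /\ (int_sq mu f < +oo)%E ->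
    continuous w /\ (int_sq mu w < +oo)%E ->
    mu.-integrable [set: borel G] (EFin \o (fun g => f g * w g)).
  by move=> [? ?] [? ?]; exact: integrable_mul.
have IRR i j := mulI _ _ (cxk_Re P1 i j) (cxk_Re P2 i j).
have III i j := mulI _ _ (cxk_Im P1 i j) (cxk_Im P2 i j).
have IRI i j := mulI _ _ (cxk_Re P1 i j) (cxk_Im P2 i j).
have IIR i j := mulI _ _ (cxk_Im P1 i j) (cxk_Re P2 i j).
have RE : (fun g => Re (phi g)) = (fun g => \sum_i \sum_j
    (Re (M1 g i j) * Re (M2 g i j) - Im (M1 g i j) * Im (M2 g i j))).
  apply/funext => g; rewrite /phi complex_Re_sum; apply: eq_bigr => i _.
  by rewrite complex_Re_sum; apply: eq_bigr => j _; rewrite complex_ReM.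
have IE : (fun g => Im (phi g)) = (fun g => \sum_i \sum_j
    (Re (M1 g i j) * Im (M2 g i j) + Im (M1 g i j) * Re (M2 g i j))).
  apply/funext => g; rewrite /phi complex_Im_sum; apply: eq_bigr => i _.
  by rewrite complex_Im_sum; apply: eq_bigr => j _; rewrite complex_ImM.
have sumI (F : I -> I -> G -> R) :
    (forall i j, mu.-integrable [set: borel G] (EFin \o F i j)) ->
    mu.-integrable [set: borel G] (fun g => (\sum_i \sum_j F i j g)%:E) /\
    Rintegral mu setT (fun g => \sum_i \sum_j F i j g) =
      \sum_i \sum_j Rintegral mu setT (F i j).
  have sum1 (F1 : I -> G -> R) :
      (forall i, mu.-integrable [set: borel G] (EFin \o F1 i)) ->
      mu.-integrable [set: borel G] (EFin \o (fun g => \sum_i F1 i g)) /\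
      Rintegral mu setT (fun g => \sum_i F1 i g) = \sum_i Rintegral mu setT (F1 i).
    move=> H; elim: (index_enum I) => [|i r [IH1 IH2]].
      have -> : (fun g => \sum_(i <- [::]) F1 i g) = cst 0.
        by apply/funext => g; rewrite big_nil.
      by rewrite big_nil /Rintegral integral0; split => //; exact: integrable0.
    have -> : (fun g => \sum_(j <- i :: r) F1 j g) = (fun g => F1 i g + \sum_(j <- r) F1 j g).
      by apply/funext => g; rewrite big_cons.
    rewrite big_cons -IH2 RintegralD//; split => //.
    exact: (integrableD measurableT (H i) IH1).
  move=> H; have H1 i := (sum1 (F i) (H i)).1.
  have [H2 ->] := sum1 (fun i g => \sum_j F i j g) H1; split => //.
  by apply: eq_bigr => i _; rewrite (sum1 (F i) (H i)).2.
have RI i j := integrableB measurableT (IRR i j) (III i j).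
have II i j := integrableD measurableT (IRI i j) (IIR i j).
have [ReI ReE] := sumI (fun i j g =>
  Re (M1 g i j) * Re (M2 g i j) - Im (M1 g i j) * Im (M2 g i j)) RI.
have [ImI ImE] := sumI (fun i j g =>
  Re (M1 g i j) * Im (M2 g i j) + Im (M1 g i j) * Re (M2 g i j)) II.
split.
  split; first by rewrite (_ : (fun _ => _) = (EFin \o (fun g => Re (phi g))))// RE.
  by rewrite (_ : (fun _ => _) = (EFin \o (fun g => Im (phi g))))// IE.
rewrite complex_ge0 /cintegral /= RE ReE; apply/andP; split.
  have cphi : continuous (fun g => Im (phi g)).
    rewrite IE => g; apply: cvg_big => [|i _]; first exact: add_continuous.
    apply: cvg_big => [|j _]; first exact: add_continuous.
    apply: cvgD; apply: cvgM.
    + exact: (cxk_Re P1 i j).1.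
    + exact: (cxk_Im P2 i j).1.
    + exact: (cxk_Im P1 i j).1.
    + exact: (cxk_Re P2 i j).1.
  have phiV g : Im (phi g^-1%g) = - Im (phi g).
    have -> : phi g^-1%g = (phi g)^*%C.
      rewrite /phi conj_sum exchange_big; apply: eq_bigr => i _.
      rewrite conj_sum; apply: eq_bigr => j _.
      by rewrite (cxk_conj P1) (cxk_conj P2) rmorphM.
    by case: (phi g).
  have Iphi : mu.-integrable [set: borel G] (EFin \o (fun g => Im (phi g))).
    by rewrite IE.
  have VE : (fun g => Im (phi g^-1%g)) = (fun g => -1 * Im (phi g)).
    by apply/funext => g; rewrite phiV mulN1r.
  have IphiV : mu.-integrable [set: borel G] (EFin \o (fun g => Im (phi g^-1%g))).
    by rewrite VE; exact: (integrableZl measurableT (-1) Iphi).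
  have := Rintegral_inv hausG mu_haar cphi Iphi IphiV.
  rewrite VE RintegralZl// => H; apply/eqP; lra.
pose RR i j := Rintegral mu setT (fun g => Re (M1 g i j) * Re (M2 g i j)).
pose IJ i j := Rintegral mu setT (fun g => Im (M1 g i j) * Im (M2 g i j)).
have P2c := cx_kernel_conj P2.
have FE i e j d : Rintegral mu setT (fun g => realify M1 g (i, e) (j, d) *
    realify (fun g i j => (M2 g i j)^*%C) g (i, e) (j, d)) =
    if e == d then RR i j else - IJ i j.
  rewrite /realify /=; case: eqP => _.
    by apply: eq_Rintegral => g _; case: (M2 g i j).
  rewrite -[RHS]mulN1r /IJ -RintegralZl//; apply: eq_Rintegral => g _.
  by case: (M2 g i j) => u v /=; case: e; rewrite ?expr1 ?expr0; ring.
have := kernel_positivity hausG mu_haar (realify_l2_kernel P1) (realify_l2_kernel P2c).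
suff -> : \sum_i ipL2 mu (mx_kernel (realify M1) (1%g, i) : _ -> R^o)
    (mx_kernel (realify (fun g i j => (M2 g i j)^*%C)) (1%g, i)) =
    2 * \sum_i \sum_j Rintegral mu setT (fun g => Re (M1 g i j) * Re (M2 g i j) -
       Im (M1 g i j) * Im (M2 g i j)).
  by rewrite pmulr_rge0.
rewrite /ipL2 exchange_big /=.
under eq_bigr => b _ do under eq_bigr => a _ do under eq_Rintegral => g _ do
  rewrite (mx_kernelE (realify_l2_kernel P1)) (mx_kernelE (realify_l2_kernel P2c)) /= invg1 mul1g.
rewrite -(pair_bigA _ (fun i e => \sum_a Rintegral mu setT (fun g => realify M1 g (i, e) a *
    realify (fun g i j => (M2 g i j)^*%C) g (i, e) a))) /=.
rewrite mulr_sumr; apply: eq_bigr => i _.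
rewrite big_bool /= -!(pair_bigA _ (fun j d => Rintegral mu setT (fun g =>
  realify M1 g (i, _) (j, d) * realify (fun g i j => (M2 g i j)^*%C) g (i, _) (j, d)))) /=.
rewrite -big_split mulr_sumr; apply: eq_bigr => j _.
by rewrite /= !big_bool !FE /= RintegralB// -/(RR i j) -/(IJ i j); ring.
Qed.

End ComplexKernels.

Lemma complex_ReN (R : realType) (x : R[i]) : complex.Re (- x) = - complex.Re x.
Proof. by case: x. Qed.

Section HilbertSpace.
Context (R : realType) (H : hilbertType R).
Implicit Types (u v w : H).

Lemma ipDl u v w : ip (u + v) w = ip u w + ip v w.
Proof. by have := ip_linearl w 1 u v; rewrite !scale1r. Qed.

Lemma ip0l w : ip 0 w = 0 :> R[i].
Proof.
by have := ipDl 0 0 w; rewrite addr0 => /eqP; rewrite -subr_eq0 opprD addNKr oppr_eq0 => /eqP.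
Qed.

Lemma ipZl (c : R[i]) u w : ip (c *: u) w = c * ip u w.
Proof. by have := ip_linearl w c u 0; rewrite !addr0 ip0l addr0. Qed.

Lemma ipDr u v w : ip w (u + v) = ip w u + ip w v.
Proof. by rewrite ipC ipDl rmorphD /= -!ipC. Qed.

Lemma ipZr (c : R[i]) u w : ip w (c *: u) = c^*%C * ip w u.
Proof. by rewrite ipC ipZl rmorphM /= -ipC. Qed.

Lemma ipBl u v w : ip (u - v) w = ip u w - ip v w.
Proof. by rewrite -scaleN1r ipDl ipZl mulN1r. Qed.

Lemma ipBr u v w : ip w (u - v) = ip w u - ip w v.
Proof. by rewrite ipC ipBl rmorphB /= -!ipC. Qed.

Lemma ip_suml (J : Type) (r : seq J) (F : J -> H) w :
  ip (\sum_(j <- r) F j) w = \sum_(j <- r) ip (F j) w.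
Proof. by elim: r => [|j r IH]; rewrite ?big_nil ?ip0l// !big_cons ipDl IH. Qed.

Lemma ip_sumr (J : Type) (r : seq J) (F : J -> H) w :
  ip w (\sum_(j <- r) F j) = \sum_(j <- r) ip w (F j).
Proof.
rewrite ipC ip_suml rmorph_sum /=; apply: eq_bigr => j _.
by rewrite -ipC.
Qed.

Lemma ip_ge0 u : 0 <= ip u u :> R[i].
Proof. by rewrite ip_norm exprn_ge0. Qed.

Lemma ip_eq0 u : ip u u = 0 :> R[i] -> u = 0.
Proof. by rewrite ip_norm => /eqP; rewrite sqrf_eq0 normr_eq0 => /eqP. Qed.

Lemma ip_Re_CS u v :
  complex.Re (ip u v) ^+ 2 <= complex.Re (ip u u) * complex.Re (ip v v).
Proof.
have Re_ge0 w : 0 <= complex.Re (ip w w) by have := ip_ge0 w; rewrite complex_ge0 => /andP[].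
apply: quadratic_ge0 => // t; have := Re_ge0 (u + t%:C%C *: v).
rewrite !(ipDl, ipDr, ipZl, ipZr) !complex_ReD !complex_ReM /=.
rewrite (ipC v u); case: (ip u v) => x y; case: (ip u u) => ? ?; case: (ip v v) => ? ? /=.
by lra.
Qed.

Lemma ip_Im u v : complex.Im (ip u v) = complex.Re (ip u (Complex 0 1 *: v)).
Proof. by rewrite ipZr complex_ReM /=; ring. Qed.

Section Coefficients.
Context (G : topGroupType) (sigma : G -> H -> H).
Hypothesis sigmaP : unitary_rep sigma.

Lemma coefficient_Re_continuous u v :
  continuous (fun g => complex.Re (ip (sigma g u) v)).
Proof.
move=> g0; apply/cvgrPdist_le => e e0.
pose B := complex.Re (ip v v) + 1.
have v0 : 0 <= complex.Re (ip v v) by have := ip_ge0 v; rewrite complex_ge0 => /andP[].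
have B0 : 0 < B by rewrite ltr_wpDl.
pose d := e / B.
have d0 : 0 < d by rewrite divr_gt0.
have dC : 0 < d%:C%C :> R[i] by rewrite ltcR.
have cu : continuous (fun g => sigma g u) by exact: urep_continuous.
have /cvgrPdist_lt/(_ _ dC) := cu g0.
apply: filterS => g Hg.
rewrite -complex_ReN -complex_ReD -ipBl; set w := sigma g0 u - sigma g u in Hg *.
rewrite -ler_sqr ?nnegrE ?(ltW e0)// real_normK ?num_real//.
apply: le_trans (ip_Re_CS w v) _.
have ww : complex.Re (ip w w) <= d ^+ 2.
  rewrite ip_norm; move: (normr_ge0 w) Hg; case: `|w| => x y.
  rewrite complex_ge0 ltcE /= => /andP[/eqP -> x0] /andP[_ xd].
  by rewrite mulr0 subr0 expr2; apply: ler_pM => //; exact: ltW.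
apply: le_trans (ler_wpM2r v0 ww) _.
rewrite /d expr_div_n mulrAC ler_pdivrMr ?exprn_gt0// ler_wpM2l ?sqr_ge0//.
rewrite expr2 /B; nra.
Qed.

Lemma coefficient_Im_continuous u v :
  continuous (fun g => complex.Im (ip (sigma g u) v)).
Proof. under eq_fun do rewrite ip_Im; exact: coefficient_Re_continuous. Qed.

Lemma coefficient_inv g u v : ip (sigma g^-1%g u) v = (ip (sigma g v) u)^*%C.
Proof.
by rewrite -(urep_ip sigmaP g) -(urepM sigmaP) mulgV (urep1 sigmaP) ipC.
Qed.

Lemma coefficient_kernel g h u v :
  ip (sigma (h^-1 * g)%g u) v = ip (sigma g u) (sigma h v).
Proof. by rewrite -(urep_ip sigmaP h) -(urepM sigmaP) mulgA mulgV mul1g. Qed.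

End Coefficients.
End HilbertSpace.

(* Schur's product theorem for Gram matrices: projecting orthogonally to the
   first second component splits off a nonnegative term and reduces the size
   of the family. *)
Lemma gram_schur_ge0 (R : realType) (H K : hilbertType R) (s : seq (H * K)) :
  0 <= \sum_(p <- s) \sum_(q <- s) ip p.1 q.1 * ip p.2 q.2 :> R[i].
Proof.
move: {2}(size s) (erefl (size s)) => n; elim: n s => [|n IH] [|[x0 y0] s]//=.
  by rewrite big_nil.
move=> [sn].
pose n0 : R[i] := ip y0 y0.
pose f y := y - (ip y y0 / n0) *: y0.
have n0C : n0^*%C = n0 by rewrite /n0 -ipC.
have fE y z : ip y z = ip (f y) (f z) + n0^-1 * (ip y y0 * (ip z y0)^*%C).
  have [y00|y00] := eqVneq y0 0.
    have z0 w : ip w y0 = 0 :> R[i] by rewrite y00 ipC ip0l rmorph0.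
    by rewrite /f !z0 !mul0r !scale0r !subr0 mulr0 addr0.
  have n00 : n0 != 0 by apply: contra_neq y00; exact: ip_eq0.
  rewrite /f !(ipBl, ipBr, ipZl, ipZr) -/n0 (ipC y0 z) rmorphM fmorphV /= n0C.
  by field.
have f0 : f y0 = 0.
  have [->|y00] := eqVneq y0 0; first by rewrite /f ip0l mul0r scale0r subr0.
  have n00 : n0 != 0 by apply: contra_neq y00; exact: ip_eq0.
  by rewrite /f -/n0 divff// scale1r subrr.
pose X := \sum_(p <- (x0, y0) :: s) ip p.2 y0 *: p.1.
have -> : \sum_(p <- (x0, y0) :: s) \sum_(q <- (x0, y0) :: s) ip p.1 q.1 * ip p.2 q.2 =
    \sum_(p <- s) \sum_(q <- s) ip p.1 q.1 * ip (f p.2) (f q.2) + n0^-1 * ip X X :> R[i].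
  transitivity (\sum_(p <- (x0, y0) :: s) \sum_(q <- (x0, y0) :: s)
      (ip p.1 q.1 * ip (f p.2) (f q.2)) +
      \sum_(p <- (x0, y0) :: s) \sum_(q <- (x0, y0) :: s)
       n0^-1 * (ip p.2 y0 * (ip q.2 y0)^*%C * ip p.1 q.1)).
    rewrite -big_split; apply: eq_bigr => p _; rewrite -big_split; apply: eq_bigr => q _.
    by rewrite /= [in LHS]fE; ring.
  congr (_ + _).
    rewrite big_cons [X in X + _]big1 ?add0r; last first.
      by move=> q _; rewrite /= f0 ip0l mulr0.
    apply: eq_bigr => p _; rewrite big_cons /= f0 (ipC (f p.2) 0) ip0l rmorph0 mulr0 add0r.
    by [].
  rewrite /X ip_suml mulr_sumr; apply: eq_bigr => p _.
  rewrite ipZl ip_sumr mulr_sumr mulr_sumr; apply: eq_bigr => q _.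
  by rewrite ipZr; ring.
rewrite addr_ge0//; last by rewrite mulr_ge0 ?invr_ge0 ?ip_ge0.
have := IH [seq (p.1, f p.2) | p <- s]; rewrite size_map => /(_ sn).
rewrite big_map => Hs; apply: le_trans Hs _; rewrite le_eqVlt; apply/orP; left; apply/eqP.
by apply: eq_bigr => p _; rewrite big_map.
Qed.

Lemma unitary_rep_comp (R : realType) (H : hilbertType R) (T T' : topGroupType)
    (f : T -> T') (sigma : T' -> H -> H) :
  continuous_hom f -> unitary_rep sigma -> unitary_rep (fun g => sigma (f g)).
Proof.
move=> [cf fM] sP.
have f1 : f 1%g = 1%g.
  by apply: (@mulgI _ (f 1%g)); rewrite -fM !mulg1.
split.
- by move=> g; exact: (urep_linear sP).
- by move=> g; exact: (urep_ip sP).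
- by move=> v; rewrite f1; exact: (urep1 sP).
- by move=> g h v; rewrite fM; exact: (urepM sP).
- move=> v g; apply: (@continuous_comp _ _ _ f (fun g => sigma g v)); first exact: cf.
  exact: (urep_continuous sP).
Qed.

Section ScalarKernels.
Context (R : realType) (G : topGroupType)
  (mu : {measure set (borel G) -> \bar R}) (I : finType).

Lemma square_integrable_int_sq (f : G -> R[i]) : square_integrable mu f ->
  (int_sq mu (fun g => complex.Re (f g)) < +oo)%E /\
  (int_sq mu (fun g => complex.Im (f g)) < +oo)%E.
Proof.
move=> [_ _ foo].
have sqE (z : R[i]) : complex.Re (`|z| ^+ 2) = complex.Re z ^+ 2 + complex.Im z ^+ 2.
  case: z => x y; rewrite normc_def /= mulr0 subr0 -expr2 sqr_sqrtr//.
  by rewrite addr_ge0 ?sqr_ge0.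
by split; apply: le_lt_trans foo; apply: ge0_le_integral_nonmeas => g _;
  rewrite lee_fin ?sqr_ge0// sqE ?lerDl ?lerDr sqr_ge0.
Qed.

Variables (H : hilbertType R) (sigma : G -> H -> H) (sigmaP : unitary_rep sigma).

Lemma coefficient_cx_kernel (a : I -> H) :
  (forall i j, square_integrable mu (fun g => ip (sigma g (a i)) (a j))) ->
  cx_kernel mu (fun g i j => ip (sigma g (a i)) (a j)).
Proof.
move=> sq; split.
- move=> i j; split; last by have [] := square_integrable_int_sq (sq i j).
  exact: coefficient_Re_continuous.
- move=> i j; split; last by have [] := square_integrable_int_sq (sq i j).
  exact: coefficient_Im_continuous.
- by move=> g i j; exact: coefficient_inv.
- move=> s; pose X := \sum_(p <- s) p.1 *: sigma p.2.1 (a p.2.2).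
  apply: le_trans (ip_ge0 X) _; rewrite le_eqVlt; apply/orP; left; apply/eqP.
  rewrite /X ip_suml; apply: eq_bigr => p _; rewrite ip_sumr; apply: eq_bigr => q _.
  by rewrite ipZl ipZr (coefficient_kernel sigmaP) mulrA.
Qed.

Variables (K : hilbertType R) (pi : G -> K -> K) (piP : unitary_rep pi).

Lemma coefficient_mul_cx_kernel (a : I -> H) (u : K) :
  (forall i j, square_integrable mu
    (fun g => ip (sigma g (a i)) (a j) * ip (pi g u) u)) ->
  cx_kernel mu (fun g i j => ip (sigma g (a i)) (a j) * ip (pi g u) u).
Proof.
move=> sq.
have cRe i j : continuous (fun g => complex.Re (ip (sigma g (a i)) (a j))).
  exact: coefficient_Re_continuous.
have cIm i j : continuous (fun g => complex.Im (ip (sigma g (a i)) (a j))).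
  exact: coefficient_Im_continuous.
have dRe : continuous (fun g => complex.Re (ip (pi g u) u)).
  exact: coefficient_Re_continuous.
have dIm : continuous (fun g => complex.Im (ip (pi g u) u)).
  exact: coefficient_Im_continuous.
split.
- move=> i j; split; last by have [] := square_integrable_int_sq (sq i j).
  under eq_fun do rewrite complex_ReM.
  by move=> g; apply: cvgB; apply: cvgM; [exact: cRe|exact: dRe|exact: cIm|exact: dIm].
- move=> i j; split; last by have [] := square_integrable_int_sq (sq i j).
  under eq_fun do rewrite complex_ImM.
  by move=> g; apply: cvgD; apply: cvgM; [exact: cRe|exact: dIm|exact: cIm|exact: dRe].
- by move=> g i j; rewrite (coefficient_inv sigmaP) (coefficient_inv piP) rmorphM.
- move=> s.
  have := gram_schur_ge0 [seq (p.1 *: sigma p.2.1 (a p.2.2), pi p.2.1 u) | p <- s].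
  move=> H0; apply: le_trans H0 _; rewrite le_eqVlt; apply/orP; left; apply/eqP.
  rewrite big_map; apply: eq_bigr => p _; rewrite big_map; apply: eq_bigr => q _ /=.
  by rewrite ipZl ipZr (coefficient_kernel sigmaP) (coefficient_kernel piP) !mulrA.
Qed.

End ScalarKernels.

Theorem corollary7p1 (R : realType)
  (k : local_kind) (F : topFieldType) (F_local : is_local_field R k F)
  (psi : F -> R[i]) (psi_char : additive_character psi)
  (N1 N2 : nat) (J1 : 'M[F]_N1) (J2 : 'M[F]_N2)
  (J1_symp : symplectic_form J1) (J2_symp : symplectic_form J2)
  (G G' : set 'M[F]_(N1 + N2)) (G1' : set 'M[F]_N1) (G2' : set 'M[F]_N2)
  (pairs : split_dual_pair J1 J2 G G' G1' G2')
  (Mp Mp1 Mp2 : topGroupType) (H H1 H2 : hilbertType R)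
  (p : Mp -> 'M[F]_(N1 + N2)) (omega : Mp -> H -> H)
  (p1 : Mp1 -> 'M[F]_N1) (omega1 : Mp1 -> H1 -> H1)
  (p2 : Mp2 -> 'M[F]_N2) (omega2 : Mp2 -> H2 -> H2)
  (osc : oscillator_rep psi (block_mx J1 0 0 J2) p omega)
  (osc1 : oscillator_rep psi J1 p1 omega1)
  (osc2 : oscillator_rep psi J2 p2 omega2)
  (tG : topGroupType) (q : tG -> 'M[F]_(N1 + N2))
  (j : tG -> Mp) (j1 : tG -> Mp1) (j2 : tG -> Mp2)
  (cover : induced_cover G p p1 p2 q j j1 j2)
  (mu : {measure set (borel tG) -> \bar R}) (mu_haar : haar_measure mu)
  (tau : H1 -> H2 -> H) (tau_tensor : hilbert_tensor tau)
  (tau_equiv : forall g a c,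
     omega (j g) (tau a c) = tau (omega1 (j1 g) a) (omega2 (j2 g) c))
  (K : hilbertType R) (pi : tG -> K -> K)
  (pi_unitary : unitary_rep pi) (pi_irr : irreducible_family pi)
  (L2_1 : forall a b, smooth k omega1 a -> smooth k omega1 b ->
     square_integrable mu (fun g => ip (omega1 (j1 g) a) b))
  (L2_2 : forall c d v w, smooth k omega2 c -> smooth k omega2 d ->
     smooth k pi v -> smooth k pi w ->
     square_integrable mu
       (fun g => ip (omega2 (j2 g) c) d * ip (pi g v) w))
  (xi : H) (xi_smooth : tensor_sums tau (smooth k omega1) (smooth k omega2) xi)
  (u : K) (u_smooth : smooth k pi u) :
  let phi := fun g => ip (omega (j g) xi) xi * ip (pi g u) u in
  cintegrable mu phi /\ 0 <= cintegral mu phi.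
Proof.
move=> phi.
have hausG : hausdorff_space tG := cover_hausdorff (ind_cover cover).
have U1 := unitary_rep_comp (ind_hom1 cover) (osc_unitary osc1).
have U2 := unitary_rep_comp (ind_hom2 cover) (osc_unitary osc2).
have [r [a [c [ac xiE]]]] := xi_smooth.
have M1 := coefficient_cx_kernel U1 (fun i j => L2_1 _ _ (ac i).1 (ac j).1).
have M2 := coefficient_mul_cx_kernel U2 pi_unitary
  (fun i j => L2_2 _ _ _ _ (ac i).2 (ac j).2 u_smooth u_smooth).
suff -> : phi = fun g => \sum_i \sum_j ip (omega1 (j1 g) (a i)) (a j) *
    (ip (omega2 (j2 g) (c i)) (c j) * ip (pi g u) u).
  exact: (cx_kernel_positivity hausG mu_haar M1 M2).
apply/funext => g; rewrite /phi xiE.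
have omega_sum (J : Type) (s : seq J) (v : J -> H) :
    omega (j g) (\sum_(i <- s) v i) = \sum_(i <- s) omega (j g) (v i).
  have oL := urep_linear (osc_unitary osc) (j g).
  have oD x y : omega (j g) (x + y) = omega (j g) x + omega (j g) y.
    by have := oL 1 x y; rewrite !scale1r.
  have o0 : omega (j g) 0 = 0.
    by have := oL (-1) 0 0; rewrite scaleN1r oppr0 addr0 scaleN1r addNr.
  by elim: s => [|i s IH]; rewrite ?big_nil// !big_cons oD IH.
rewrite omega_sum ip_suml mulr_suml; apply: eq_bigr => i _.
rewrite ip_sumr mulr_suml; apply: eq_bigr => l _.
by rewrite tau_equiv (tensor_ip tau_tensor) mulrA.
Qed.
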